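(* Let $p\in[1,+\infty]$, let $\Sigma\subset\mathbb R^2$ be a damping set, let $S$ be the set-valued map whose graph is $R\Sigma$, and let $\mu:\mathbb R_+\to\mathbb R_+$ be defined by $\mu(r)=\lim_{\eta\to0^+}\sup_{|x|\le r+\eta}\|S(x)\|$. Assume that $\mu(r)<r$ for every $r>0$. (a) Let $d\in L^p_{\mathrm{loc}}(\mathbb R_+,\mathbb R^2)$ and let $z$ be a solution in $\mathsf X_p$ of the disturbed wave equation associated with $\Sigma$ and the disturbance $d$. Then $e_p(z)(t)\to0$ as $t\to+\infty$ if one of the following conditions holds: (a-i) $p<+\infty$ and $d\in\mathcal D_p$; (a-ii) $d(t)\to0$ as $t\to+\infty$ and, for every $\varepsilon>0$, one has $\inf_{r\ge\varepsilon}(r-\mu(r))>0$. (b) The disturbed wave equation associated with $\Sigma$ is ISS with respect to $\mathsf X_p$ and $L^p(\mathbb R_+,\mathbb R^2)$ if one of the following conditions holds: (b-i) $p=+\infty$ and $\lim_{r\to+\infty}(r-\mu(r))=+\infty$; (b-ii) $p<+\infty$ and there exist positive constants $M,a,b$ such that $a|x|\le|y|\le b|x|$ for every $(x,y)\in\Sigma\setminus B(0,M)$.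
   Context: Notation: $\mathbb R_+=[0,+\infty)$, $R=\begin{pmatrix}\frac1{\sqrt2}&\frac1{\sqrt2}\\-\frac1{\sqrt2}&\frac1{\sqrt2}\end{pmatrix}$, $R\Sigma=\{R\xi:\xi\in\Sigma\}$, $\Sigma+v=\{\xi+v:\xi\in\Sigma\}$; $B(0,M)$ is the Euclidean ball of $\mathbb R^2$ centered at $0$ of radius $M$. The graph of $S:\mathbb R\rightrightarrows\mathbb R$ is $\{(x,y):y\in S(x)\}$. For $A\subset\mathbb R$, $\|A\|=\sup_{a\in A}|a|$. $L^p_{\mathrm{loc}}(a,+\infty)$ is the set of measurable functions whose restriction to $(a,T)$ is in $L^p$ for every $T>a$; $L^p_{\mathrm{loc}}(\mathbb R_+,\mathbb R^2)$ is the set of measurable $d:\mathbb R_+\to\mathbb R^2$ in $L^p(0,T)$ for every $T>0$. $L^p(\mathbb R_+,\mathbb R^2)$ carries its usual norm with Euclidean norm on $\mathbb R^2$. $W^{1,p}_*(0,1)=\{u\in L^p(0,1): u'\in L^p(0,1),\ u(0)=0\}$ and $\mathsf X_p=W^{1,p}_*(0,1)\times L^p(0,1)$, with norm $\|(u,v)\|_{\mathsf X_p}^p=2^{-p/2}\int_0^1(|u'+v|^p+|u'-v|^p)\,dx$ if $p<+\infty$ and $\|(u,v)\|_{\mathsf X_\infty}=\frac1{\sqrt2}\max(\|u'+v\|_{L^\infty(0,1)},\|u'-v\|_{L^\infty(0,1)})$. The disturbed wave equation associated with $\Sigma$ and a measurable disturbance $d:\mathbb R_+\to\mathbb R^2$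 is: $z_{tt}=z_{xx}$ on $\mathbb R_+\times[0,1]$; $z(t,0)=0$ and $(z_t(t,1),-z_x(t,1))\in\Sigma+d(t)$ for $t\in\mathbb R_+$; $z(0,x)=z_0(x)$, $z_t(0,x)=z_1(x)$ for $x\in[0,1]$. A (weak, global in time) solution (trajectory) in $\mathsf X_p$ with initial condition $(z_0,z_1)\in\mathsf X_p$ is a function $z:\mathbb R_+\times[0,1]\to\mathbb R$ for which there exist $f\in L^p_{\mathrm{loc}}(0,+\infty)$ and $g\in L^p_{\mathrm{loc}}(-1,+\infty)$ such that $z(t,x)=\frac1{\sqrt2}\int_0^{t+x}f+\frac1{\sqrt2}\int_0^{t-x}g$ for all $(t,x)$, $z(t,0)=0$ and $(z_t(t,1),-z_x(t,1))\in\Sigma+d(t)$ for a.e. $t\in\mathbb R_+$, and $z(0,x)=z_0(x)$, $z_t(0,x)=z_1(x)$ for a.e. $x\in[0,1]$; here $z_t(t,x)=\frac{f(t+x)+g(t-x)}{\sqrt2}$ and $z_x(t,x)=\frac{f(t+x)-g(t-x)}{\sqrt2}$. Set $e_p(z)(t)=\|(z(t,\cdot),z_t(t,\cdot))\|_{\mathsf X_p}$. For $p\in[1,+\infty)$, $\mathcal D_p$ is the set of measurable $d:\mathbb R_+\to\mathbb R^2$ such that the function $D(s)=\sum_{n=0}^\infty|d(s+2n+1)|$, $s\in[-1,1]$, belongs to $L^p(-1,1)$. Damping set: $\Sigma$ is a damping set if $(0,0)\in\Sigma$, $xy\ge0$ for every $(x,y)\in\Sigma$, and $R\Sigma$ contains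 the graph of a universally measurable function $\varphi:\mathbb R\to\mathbb R$ with linear growth ($|\varphi(x)|\le a|x|+b$ for some $a,b\ge0$). A set $M\subset\mathbb R$ is universally measurable if for every Borel probability measure $\nu$ on $\mathbb R$ there exist Borel sets $A\subset M\subset B$ with $\nu(B\setminus A)=0$; $\varphi$ is universally measurable if preimages of Borel sets are universally measurable. ISS: the disturbed wave equation is input-to-state stable (ISS) with respect to $\mathsf X_p$ and $L^p(\mathbb R_+,\mathbb R^2)$ if there exist a $\mathcal{KL}$ function $\beta$ and a $\mathcal K$ function $\gamma$ such that, for every initial condition in $\mathsf X_p$, every $d\in L^p(\mathbb R_+,\mathbb R^2)$ and every corresponding solution $z$, $e_p(z)(t)\le\beta(e_p(z)(0),t)+\gamma(\|d\|_{L^p(\mathbb R_+,\mathbb R^2)})$ for all $t\ge0$. A $\mathcal K$ function is a continuous increasing $\gamma:\mathbb R_+\to\mathbb R_+$ with $\gamma(0)=0$. A $\mathcal{KL}$ function is a continuous $\beta:\mathbb R_+\times\mathbb R_+\to\mathbb R_+$ such that $\beta(\cdot,t)$ is a $\mathcal K$ function for every $t$, and for each $x>0$, $\beta(x,\cdot)$ is decreasing and tends to $0$ at $+\infty$. *)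

(* Defs.v *)
From HB Require Import structures.
From mathcomp Require Import all_boot all_order all_algebra.
From mathcomp Require Import all_classical all_reals all_analysis.
From mathcomp Require Import measurable_realfun.

Set Implicit Arguments.
Unset Strict Implicit.
Unset Printing Implicit Defensive.
Import Order.TTheory GRing.Theory Num.Theory.
Import numFieldNormedType.Exports.

Local Open Scope classical_set_scope.
Local Open Scope ring_scope.

(** Points of the plane are pairs
    [R * R]; as the library norm on a product is the sup norm, the Euclidean
    norm is [enorm].  A function on [R_+], on [(a, +oo)] or on [[0, 1]] is a
    total function on [R] whose values elsewhere are never used. *)

Section plane.
Context {R : realType}.
Implicit Types (xi v : R * R) (Sigma : set (R * R)).

Definition enorm v : R := Num.sqrt (v.1 ^+ 2 + v.2 ^+ 2).

Definition rotation xi : R * R :=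
  ((xi.1 + xi.2) / Num.sqrt 2, (- xi.1 + xi.2) / Num.sqrt 2).

Definition translate Sigma v : set (R * R) :=
  [set (xi.1 + v.1, xi.2 + v.2) | xi in Sigma].

Definition setnorm (A : set R) : \bar R := ereal_sup [set `|a|%:E | a in A].

End plane.

Section damping.
Context {R : realType}.

Definition universally_measurable (M : set R) : Prop :=
  forall nu : probability (measurableTypeR R) R,
  exists A B : set (measurableTypeR R),
    [/\ measurable A, measurable B, A `<=` M, M `<=` B & nu (B `\` A) = 0%E].

Definition universally_measurable_fun (phi : R -> R) : Prop :=
  forall Y : set R, measurable Y -> universally_measurable (phi @^-1` Y).

Definition linear_growth (phi : R -> R) : Prop :=
  exists a b : R, [/\ 0 <= a, 0 <= b & forall x, `|phi x| <= a * `|x| + b].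

Definition damping_set (Sigma : set (R * R)) : Prop :=
  [/\ Sigma (0, 0),
      forall x y, Sigma (x, y) -> 0 <= x * y
    & exists phi : R -> R,
        [/\ universally_measurable_fun phi, linear_growth phi
          & forall x, (rotation @` Sigma) (x, phi x)]].

End damping.

Section Lp.
Context {R : realType}.
Implicit Types (p : \bar R) (D : set R) (d : R -> R * R).
Local Notation leb := (@lebesgue_measure R).

(** Measurability with respect to the Lebesgue sigma-algebra, as opposed to the
    Borel one, which is the library default on [R].  Despite its name,
    [completed_algebra_gen leb] is that whole sigma-algebra (see
    [g_sigma_completed_algebra_genE]).  On such functions the integral and the
    essential supremum of the library with respect to [lebesgue_measure] have
    their usual Lebesgue values. *)
Definition lebesgue_measurable_fun dT (T : measurableType dT) D (f : R -> T) :
    Prop :=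
  forall Y : set T, measurable Y -> completed_algebra_gen leb (D `&` f @^-1` Y).

(** The extension by zero outside [D] does not change the norm on [D], also for
    the essential supremum since absolute values are nonnegative. *)
Definition Lpnorm p D (f : R -> \bar R) : \bar R := 'N[leb]_p[f \_ D].

Definition Lp p D (f : R -> R) : Prop :=
  lebesgue_measurable_fun D f /\ (Lpnorm p D (EFin \o f) < +oo)%E.

Definition Lploc p (a : R) (f : R -> R) : Prop :=
  forall T : R, a < T -> Lp p `]a, T[ f.

Definition Lpnorm2 p D d : \bar R := Lpnorm p D (EFin \o (enorm \o d)).

Definition Lp2 p d : Prop :=
  lebesgue_measurable_fun `[0, +oo[ d /\ (Lpnorm2 p `[0%R, +oo[ d < +oo)%E.

Definition Lploc2 p d : Prop :=
  lebesgue_measurable_fun `[0, +oo[ d /\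
  forall T : R, 0 < T -> (Lpnorm2 p `]0%R, T[ d < +oo)%E.

Definition Dp p d : Prop :=
  lebesgue_measurable_fun `[0, +oo[ d /\
  (Lpnorm p `](-1)%R, 1%R[
     (fun s => \sum_(0 <= n <oo) (enorm (d (s + 2 * n%:R + 1)))%:E) < +oo)%E.

End Lp.

Section state_space.
Context {R : realType}.
Implicit Types (p : \bar R) (u v w : R -> R).
Local Notation leb := (@lebesgue_measure R).

Definition test_fun (phi : R -> R) : Prop :=
  (forall (n : nat) (x : R), derivable (derive1n n phi) x 1) /\
  exists a b : R, [/\ 0 < a, b < 1 & forall x, x \notin `[a, b] -> phi x = 0].

Definition weak_derivative u w : Prop :=
  forall phi, test_fun phi ->
    \int[leb]_(x in `]0, 1[) (u x * derive1 phi x) =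
    - \int[leb]_(x in `]0, 1[) (w x * phi x).

(** An element of W^{1,p}(0,1) is identified with its (absolutely) continuous
    representative, which gives a meaning to [u 0]; the classical derivative
    [derive1 u] then exists almost everywhere and is the weak derivative. *)
Definition W1p0 p u : Prop :=
  [/\ Lp p `]0, 1[ u, Lp p `]0, 1[ (derive1 u), weak_derivative u (derive1 u),
      {within `[0, 1], continuous u} & u 0 = 0].

Definition Xp p u v : Prop := W1p0 p u /\ Lp p `]0, 1[ v.

Definition Xnorm p u v : \bar R :=
  match p with
  | r%:E =>
      poweR ((2 `^ (- (r / 2)))%:E *
             \int[leb]_(x in `]0%R, 1%R[)
               (`|derive1 u x + v x| `^ r +
                `|derive1 u x - v x| `^ r)%:E)%E
            r^-1
  | +oo%E =>
      ((Num.sqrt 2)^-1%:E *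
       maxe (Lpnorm +oo%E `]0%R, 1%R[ (fun x => (derive1 u x + v x)%:E))
            (Lpnorm +oo%E `]0%R, 1%R[ (fun x => (derive1 u x - v x)%:E)))%E
  | -oo%E => 0%E (* junk value: only [1 <= p] is considered *)
  end.

End state_space.

Section wave_equation.
Context {R : realType}.
Implicit Types (p : \bar R) (f g : R -> R) (z : R -> R -> R).
Implicit Types (Sigma : set (R * R)) (d : R -> R * R).
Local Notation leb := (@lebesgue_measure R).

(** Oriented: for [x < 0] this is minus the integral over [[x, 0]]. *)
Definition integral_from0 f (x : R) : R :=
  if 0 <= x then \int[leb]_(s in `[0, x]) f s
  else - \int[leb]_(s in `[x, 0]) f s.

Definition wave_t f g (t x : R) : R := (f (t + x) + g (t - x)) / Num.sqrt 2.

Definition wave_x f g (t x : R) : R := (f (t + x) - g (t - x)) / Num.sqrt 2.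

(** [z] is a solution with initial condition [(z0, z1)] and disturbance [d];
    [f] and [g] are the two functions representing [z].  They are arguments
    because the time derivative [wave_t f g] is expressed with them. *)
Definition solution p Sigma d (z0 z1 : R -> R) z f g : Prop :=
  [/\ Lploc p 0 f /\ Lploc p (-1) g,
      forall t x : R, 0 <= t -> 0 <= x <= 1 ->
        z t x = integral_from0 f (t + x) / Num.sqrt 2 +
                integral_from0 g (t - x) / Num.sqrt 2,
      {ae leb, forall t : R, 0 <= t ->
        z t 0 = 0 /\
        translate Sigma (d t) (wave_t f g t 1, - wave_x f g t 1)}
    & {ae leb, forall x : R, 0 <= x <= 1 ->
        z 0 x = z0 x /\ wave_t f g 0 x = z1 x}].

Definition energy p z f g (t : R) : \bar R := Xnorm p (z t) (wave_t f g t).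

End wave_equation.

Section iss.
Context {R : realType}.

Definition classK (gamma : R -> R) : Prop :=
  [/\ {within `[0, +oo[, continuous gamma},
      {in `[0, +oo[ &, {homo gamma : x y / x < y}}
    & gamma 0 = 0].

Definition classKL (beta : R -> R -> R) : Prop :=
  [/\ {within [set xt : R * R | 0 <= xt.1 /\ 0 <= xt.2],
         continuous (fun xt : R * R => beta xt.1 xt.2)},
      forall t : R, 0 <= t -> classK (beta^~ t)
    & forall x : R, 0 < x ->
        {in `[0, +oo[ &, {homo beta x : s t /~ s < t}} /\
        beta x t @[t --> +oo%R] --> (0 : R)].

Definition ISS (p : \bar R) (Sigma : set (R * R)) : Prop :=
  exists (beta : R -> R -> R) (gamma : R -> R),
    [/\ classKL beta, classK gamma
      & forall (d : R -> R * R) (z0 z1 : R -> R) (z : R -> R -> R)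
               (f g : R -> R),
          Xp p z0 z1 -> Lp2 p d -> solution p Sigma d z0 z1 z f g ->
          forall t : R, 0 <= t ->
            (energy p z f g t <=
             (beta (fine (energy p z f g 0%R)) t +
              gamma (fine (Lpnorm2 p `[0%R, +oo[ d)))%:E)%E].

End iss.

(* Main.v *)
Require Import Defs.
From HB Require Import structures.
From mathcomp Require Import all_boot all_order all_algebra.
From mathcomp Require Import all_classical all_reals all_analysis.
From mathcomp Require Import measurable_realfun ess_sup_inf lra ring.

(** Why the theorem holds.

    d'Alembert's formula turns the problem into a delay relation.  At x = 0 the
    Dirichlet condition reads F + G = 0 for the primitives F, G of f, g, so
    f = - g almost everywhere on R_+ ([dirichlet_reflection]).  The quantities
    z_x + z_t and z_x - z_t are sqrt 2 f (t + x) and - sqrt 2 g (t - x), hence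
    the energy at time t is the L^p norm of g on ]t - 1, t + 1[ ([energyE]).  At
    x = 1, the rotation maps the boundary condition to
    g (t + 1) - d2' (t) \in S (g (t - 1) - d1' (t)), where (d1', d2') is the
    rotated disturbance ([boundary_relation]).  Since mu bounds S, this gives
    |g (t + 1)| <= mu (|g (t - 1)| + |d t|) + |d t| for almost every t.

    For fixed s in ]-1, 1[, the numbers y n = |g (s + 2 n)| and
    delta n = |d (s + 2 n + 1)| therefore satisfy the scalar recursion
    y (n + 1) <= mu (y n + delta n) + delta n, and the energy at time 2 n is the
    L^p norm of y n over ]-1, 1[.  The function mu is nondecreasing and
    right-continuous and satisfies mu r < r; so r - mu r is bounded below by a
    positive constant on every segment of ]0, +oo[ ([mu_gap]).  Three arguments
    about the recursion give the four cases.
    - If d belongs to D_p, the series of delta converges for almost every s; then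
      y n plus a tail of that series is nonincreasing, and its limit l satisfies
      l <= mu l, so l = 0; moreover y n <= y 0 + 2 sum delta, so dominated
      convergence applies ([recursion_cvg0], [summable_decay]).
    - If delta <= eta and r - mu r >= c >= 4 eta for r >= eps, each step lowers y
      by at least c / 2 until y <= eps + eta ([recursion_gap]).  If d tends to 0,
      this applies after a time from which d is small ([uniform_decay]); applied
      with the essential bounds of y 0 and d, it gives the stability in L^oo
      ([ISS_uniform]).
    - Under the sector condition a |x| <= |y| <= b |x|, one has mu r <= lam r for
      r >= eps with some lam < 1 depending on eps ([sector_contraction]); then the
      excess (y n - eps)^+ contracts by lam up to 2 delta n, which gives
      |y n| <= 2 eps + lam ^ n |y 0| + 2 |d| / (1 - lam) for the L^p norms
      ([contraction_estimate], [ISS_sector]).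

    The last two bounds hold for every admissible eps.  The parameters valid for a
    small eps and those valid for a large one can be merged, so that the infimum
    over eps may be taken separately in the term with the initial energy and in
    the term with the disturbance ([ISS_of_estimate]).  These infima have the
    monotonicity and the limits of functions of classes KL and K; continuity and
    strictness are obtained by sup-convolution ([classKL_majorant],
    [classK_majorant]).

    All functions given by a solution are Lebesgue measurable, while integration
    theory is about Borel functions; so f, g and |d| are first replaced by Borel
    functions that agree with them almost everywhere ([borel_representative]). *)

Set Implicit Arguments.
Unset Strict Implicit.
Unset Printing Implicit Defensive.
Import Order.TTheory GRing.Theory Num.Theory.
Import numFieldNormedType.Exports.

Local Open Scope classical_set_scope.
Local Open Scope ring_scope.

(** * Almost everywhere statements and Borel representatives *)

Section almost_everywhere.
Context {R : realType}.
Local Notation leb := (@lebesgue_measure R).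

Lemma aeS (P Q : R -> Prop) : (forall x, P x -> Q x) ->
  {ae leb, forall x, P x} -> {ae leb, forall x, Q x}.
Proof.
by move=> PQ; apply: filterS PQ; exact: (ae_filter_ringOfSetsType leb).
Qed.

Lemma ae_and (P Q : R -> Prop) : {ae leb, forall x, P x} ->
  {ae leb, forall x, Q x} -> {ae leb, forall x, P x /\ Q x}.
Proof.
by move=> hP hQ; apply: (@filterI _ _ (ae_filter_ringOfSetsType leb)).
Qed.

Lemma ae_neq (t : R) : {ae leb, forall x, x <> t}.
Proof.
exists [set t]; split => //; first exact: lebesgue_measure_set1.
by move=> x /=; apply: contra_notP.
Qed.

Lemma completed_algebra_bigcup (F : nat -> set R) :
  (forall n, completed_algebra_gen leb (F n)) ->
  completed_algebra_gen leb (\bigcup_n F n).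
Proof.
rewrite -g_sigma_completed_algebra_genE => mF.
exact: (@bigcupT_measurable _ (g_sigma_algebraType (completed_algebra_gen leb))).
Qed.

Lemma borel_representative (D : set R) (f : R -> R) :
  measurable D -> lebesgue_measurable_fun D f ->
  exists f' : R -> R, [/\ measurable_fun setT f',
    (forall x, ~ D x -> f' x = 0) &
    {ae leb, forall x, D x -> f' x = f x}].
Proof.
move=> mD mf; pose rt n : R := ratr (odflt 0 (unpickle n)).
(* The preimages of the rays with rational endpoints generate; each of them is
   Borel up to a Borel null set AZ.2. *)
have /choice[AZ hAZ] (n : nat) : exists AZ : set (measurableTypeR R) * set (measurableTypeR R),
    [/\ measurable AZ.1, measurable AZ.2, leb AZ.2 = 0,
       AZ.1 `<=` D `&` f @^-1` `]rt n, +oo[ &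
       D `&` f @^-1` `]rt n, +oo[ `<=` AZ.1 `|` AZ.2].
  have [A mA [N [B [mB B0 NB]] AN]] := mf `]rt n, +oo[%classic (measurable_itv _).
  exists (A, B); split => //=; first by rewrite -AN; exact: subsetUl.
  by rewrite -AN; exact: setUS.
pose Z := \bigcup_n (AZ n).2.
have mZ : measurable Z.
  by apply: bigcupT_measurable => q; have [] := hAZ q.
have Z0 : leb Z = 0.
  apply/negligibleP => //; apply: negligible_bigcup => n.
  by apply/negligibleP; have [] := hAZ n.
have mDZ : measurable (D `\` Z) by exact: measurableD.
have mfDZ : measurable_fun (D `\` Z) f.
  move=> _; apply: (measurability _ (RGenOInfty.measurableE R)) => //.
  move=> _ [_ [x ->] <-].
  rewrite [X in measurable X](_ : _ = \bigcup_(n in [set n | x < rt n]) ((AZ n).1 `\` Z)).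
    apply: bigcup_measurable => q _; apply: measurableD => //.
    by have [] := hAZ q.
  apply/seteqP; split => [y [[Dy Zy]]|y [n /= xn [+ Zy]]].
    rewrite /= in_itv/= andbT => xy.
    have [q qx] := rat_in_itvoo xy.
    have rq : rt (pickle q) = ratr q by rewrite /rt pickleK.
    exists (pickle q) => /=; first by rewrite rq; move: qx; rewrite in_itv => /andP[].
    split => //; have [_ _ _ _ h] := hAZ (pickle q).
    have /h[//|Zpy] : (D `&` f @^-1` `]rt (pickle q), +oo[) y.
      by split => //=; rewrite rq in_itv/= andbT; move: qx; rewrite in_itv => /andP[].
    by exfalso; apply: Zy; exists (pickle q).
  have [_ _ _ h _] := hAZ n.
  move=> /h[Dy] /=; rewrite !in_itv/= !andbT => ny; split => //.
  exact: lt_trans ny.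
exists (f \_ (D `\` Z)); split.
- by apply/(measurable_restrict f mDZ measurableT) => //; rewrite setTI.
- by move=> x Dx; rewrite patchE memNset// => -[].
exists Z; split => // x /= /not_implyP[Dx].
by apply: contra_notP => Zx; rewrite patchE mem_set.
Qed.

Import HBNNSimple.

(** The integral of a nonnegative function, Borel or not, is a supremum over the
    simple functions below it.  This transfers integrals and norms between a
    Lebesgue measurable function and its Borel representative. *)
Lemma ge0_ae_le_integral (f g : R -> \bar R) :
  (forall x, 0 <= f x)%E -> (forall x, 0 <= g x)%E ->
  {ae leb, forall x, (f x <= g x)%E} ->
  (\int[leb]_x f x <= \int[leb]_x g x)%E.
Proof.
move=> f0 g0 [N [mN N0 fgN]].
rewrite !ge0_integralTE//.
apply: ge_ereal_sup => _ /= [h hf <-].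
(* Cut off on the null set, h lies below g and keeps its integral. *)
have mNC : measurable (~` N) by exact: measurableC.
have -> : sintegral leb h = sintegral leb (proj_nnsfun h mNC).
  rewrite -!integralT_nnsfun; apply: ge0_ae_eq_integral => //.
  - exact/measurable_EFinP/measurable_funP.
  - exact/measurable_EFinP/measurable_funP.
  - by move=> x _; rewrite lee_fin.
  - by move=> x _; rewrite lee_fin.
  exists N; split => // x /= /not_implyP[_]; apply: contra_notP => Nx.
  by rewrite mindicE mem_set//= mulr1.
apply: ereal_sup_ubound; exists (proj_nnsfun h mNC) => //= x.
rewrite mindicE; case: (boolP (x \in ~` N)) => xN; rewrite ?mulr0//= mulr1.
apply: le_trans (hf x) _; move: xN; rewrite inE/= => xN.
by move: fgN => /subsetCl; apply.
Qed.

Lemma ge0_ae_eq_integral_on (D : set R) (u v : R -> \bar R) :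
  (forall x, (0 <= u x)%E) -> (forall x, (0 <= v x)%E) ->
  {ae leb, forall x, D x -> u x = v x} ->
  (\int[leb]_(x in D) u x = \int[leb]_(x in D) v x)%E.
Proof.
move=> u0 v0 uv.
have le_int (u' v' : R -> \bar R) : (forall x, (0 <= u' x)%E) -> (forall x, (0 <= v' x)%E) ->
    {ae leb, forall x, D x -> u' x = v' x} ->
    (\int[leb]_(x in D) u' x <= \int[leb]_(x in D) v' x)%E.
  move=> u0' v0' uv'; rewrite integral_mkcond [leRHS]integral_mkcond.
  apply: ge0_ae_le_integral.
  - by move=> x; rewrite patchE; case: ifP.
  - by move=> x; rewrite patchE; case: ifP.
  - apply: (aeS _ uv') => x uvx; rewrite !patchE; case: ifPn => // /set_mem /uvx ->.
    exact: lexx.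
apply/eqP; rewrite eq_le !le_int//.
by apply: (aeS _ uv) => x uvx /uvx ->.
Qed.

Lemma Rintegral_ae_eq (D : set R) (f g : R -> R) :
  {ae leb, forall x, D x -> f x = g x} ->
  \int[leb]_(x in D) f x = \int[leb]_(x in D) g x.
Proof.
move=> fg; rewrite /Rintegral; congr fine.
rewrite integralE [in RHS]integralE.
congr (_ - _)%E; apply: ge0_ae_eq_integral_on => //.
- by apply: (aeS _ fg) => x fgx /fgx fE; rewrite !funeposE fE.
- by apply: (aeS _ fg) => x fgx /fgx fE; rewrite !funenegE fE.
Qed.

End almost_everywhere.

(** * Norms over subsets of the line *)

Section norms.
Context {R : realType}.
Local Notation leb := (@lebesgue_measure R).
Implicit Types (p : \bar R) (D : set R) (u v : R -> R).

Lemma le_poweR (r : R) (x y : \bar R) :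
  0 <= r -> (0 <= x)%E -> (x <= y)%E -> (x `^ r <= y `^ r)%E.
Proof.
move=> r0 x0 xy; apply: gt0_ler_poweR => //.
  by rewrite in_itv/= x0 leey.
by rewrite in_itv/= (le_trans x0 xy) leey.
Qed.

Lemma leb_setT_gt0 : (0 < leb [set: R])%E.
Proof. by rewrite -set_itvNyy lebesgue_measure_itv/= ltry. Qed.

Lemma Lnorm_ae_le p (f g : R -> \bar R) : (1 <= p)%E ->
  {ae leb, forall x, (`|f x| <= `|g x|)%E} -> ('N[leb]_p[f] <= 'N[leb]_p[g])%E.
Proof.
rewrite unlock; case: p => //= [r|_].
  rewrite lee_fin => r1 fg.
  have r0 : 0 < r by exact: lt_le_trans r1.
  apply: le_poweR; first by rewrite invr_ge0 ltW.
    by apply: integral_ge0 => x _; exact: poweR_ge0.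
  apply: ge0_ae_le_integral => [x|x|]; [exact: poweR_ge0..|].
  apply: (aeS _ fg) => x fgx.
  by apply: le_poweR; rewrite ?abse_ge0// ltW.
by rewrite leb_setT_gt0 => fg; exact: le_ess_sup.
Qed.

Lemma Lpnorm_ae_le p (D E : set R) (f g : R -> \bar R) : (1 <= p)%E ->
  {ae leb, forall x, D x -> E x /\ (`|f x| <= `|g x|)%E} ->
  (Lpnorm p D f <= Lpnorm p E g)%E.
Proof.
move=> p1 fg; apply: Lnorm_ae_le => //.
apply: (aeS _ fg) => x /=; rewrite !patchE.
case: (boolP (x \in D)) => xD; last by rewrite abse0 abse_ge0.
by move=> /(_ (set_mem xD))[Ex fgx]; rewrite mem_set.
Qed.

Lemma Lpnorm_ae_eq p (D : set R) (f g : R -> \bar R) : (1 <= p)%E ->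
  {ae leb, forall x, D x -> (`|f x| = `|g x|)%E} ->
  Lpnorm p D f = Lpnorm p D g.
Proof.
move=> p1 fg; apply/eqP; rewrite eq_le !Lpnorm_ae_le//;
  by apply: (aeS _ fg) => x fgx Dx; rewrite fgx.
Qed.

Definition leb_preserving (T : R -> R) := measurable_fun setT T /\
  forall A : set R, measurable A -> leb (T @^-1` A) = leb A.

Lemma leb_preserving_addr (c : R) : leb_preserving (fun x => x + c).
Proof.
have mT : measurable_fun setT (fun x : R => x + c) by exact: measurable_funD.
split => // A mA; apply/esym.
change (leb A = pushforward leb (fun x : R => (x + c) : measurableTypeR R) A).
apply: lebesgue_measure_unique => //= _ [[a b]] _ <-.
rewrite /pushforward.
have -> : (fun x => x + c) @^-1` `](a, b).1, (a, b).2] = `]a - c, b - c]%classic.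
  by apply/seteqP; split => x /=; rewrite !in_itv/= ltrBlDr lerBrDr.
rewrite !lebesgue_measure_itv/= !lte_fin ltrD2r; case: ifPn => // _.
by rewrite -!EFinD; congr EFin; lra.
Qed.

Lemma leb_preserving_opp : leb_preserving -%R.
Proof.
split; first exact: oppr_measurable.
by move=> A mA; exact: lebesgue_measureN.
Qed.

Lemma leb_preserving_comp (T U : R -> R) : leb_preserving T -> leb_preserving U ->
  leb_preserving (T \o U).
Proof.
move=> [mT hT] [mU hU]; split; first exact: (measurableT_comp mT mU).
move=> A mA; rewrite comp_preimage hU ?hT//.
by rewrite -[X in measurable X]setTI; exact: mT.
Qed.

Lemma leb_preserving_subl (c : R) : leb_preserving (fun x => c - x).
Proof.
have -> : (fun x => c - x) = (fun x => x + c) \o -%R.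
  by apply/funext => x /=; rewrite addrC.
exact: leb_preserving_comp (leb_preserving_addr c) leb_preserving_opp.
Qed.

Lemma leb_preserving_ae (T : R -> R) (P : R -> Prop) : leb_preserving T ->
  {ae leb, forall x, P x} -> {ae leb, forall x, P (T x)}.
Proof.
move=> [mT hT] [N [mN N0 PN]]; exists (T @^-1` N); split.
- by rewrite -[X in measurable X]setTI; exact: mT.
- by rewrite -N0; exact: hT.
- by move=> x /PN.
Qed.

(** For a finite exponent this is the change of variables for the pushforward
    measure.  The essential supremum needs the inverse map as well: the first
    inequality pulls almost everywhere statements back along T, the second one
    along T'. *)
Lemma leb_preserving_Lnorm (T T' : R -> R) p (F : R -> \bar R) :
  (1 <= p)%E -> leb_preserving T -> leb_preserving T' -> cancel T' T ->
  measurable_fun setT F -> ('N[leb]_p[F \o T] = 'N[leb]_p[F])%E.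
Proof.
move=> + pT pT' TT' mF; rewrite unlock; case: p => //= [r _|_].
  congr (_ `^ _)%E.
  have [mT hT] := pT.
  transitivity (\int[pushforward leb (T : _ -> measurableTypeR R)]_y (`|F y| `^ r))%E.
    rewrite ge0_integral_pushforward//=.
      apply/(measurableT_comp (measurable_poweR _)).
      exact: measurableT_comp.
    by move=> *; exact: poweR_ge0.
  by apply: eq_measure_integral => // A mA _; exact: hT.
rewrite leb_setT_gt0; apply/eqP; rewrite eq_le; apply/andP; split.
  apply/ess_supP.
  exact: (leb_preserving_ae pT (ess_sup_ge leb (abse \o F))).
apply/ess_supP.
have := leb_preserving_ae pT' (ess_sup_ge leb (abse \o (F \o T))).
by apply: aeS => x /=; rewrite TT'.
Qed.

Lemma Lpnorm_preserving p D (T T' : R -> R) (h : R -> R) :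
  (1 <= p)%E -> leb_preserving T -> leb_preserving T' -> cancel T' T ->
  measurable D -> measurable_fun setT h ->
  Lpnorm p (T @^-1` D) (EFin \o (h \o T)) = Lpnorm p D (EFin \o h).
Proof.
move=> p1 pT pT' TT' mD mh.
have -> : Lpnorm p D (EFin \o h) = ('N[leb]_p[((EFin \o h) \_ D) \o T])%E.
  rewrite (leb_preserving_Lnorm _ pT pT' TT')//.
  apply/(measurable_restrict _ mD measurableT) => //; rewrite setTI.
  by apply/measurable_EFinP; exact: measurable_funTS.
by congr Lnorm; apply/funext => x /=; rewrite !patchE.
Qed.

Lemma Lpnorm_shift p (c : R) (u : R -> R) : (1 <= p)%E -> measurable_fun setT u ->
  Lpnorm p `]-1, 1[ (EFin \o (fun s => u (s + c))) =
  Lpnorm p `]c - 1, c + 1[ (EFin \o u).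
Proof.
move=> p1 mu.
have -> : `]-1, 1[%classic = (fun s => s + c) @^-1` `]c - 1, c + 1[ :> set R.
  by apply/seteqP; split => x /=; rewrite !in_itv/= -ltrBlDr addrAC subrr add0r [x + c]addrC ltrD2l.
apply: (Lpnorm_preserving (T' := fun s => s - c)) => //.
- exact: leb_preserving_addr.
- exact: leb_preserving_addr.
- exact: subrK.
Qed.

Lemma poweR_Lpnorm (r : R) D (h : R -> R) : r != 0 ->
  (Lpnorm r%:E D (EFin \o h) `^ r = \int[leb]_(x in D) (`|h x| `^ r)%:E)%E.
Proof.
move=> r0; rewrite poweR_Lnorm// [RHS]integral_mkcond; apply: eq_integral => x _.
by rewrite !patchE; case: ifP => //= _; rewrite normr0 powR0.
Qed.

Lemma Lpnorm_poweR (r : R) D (h : R -> R) : r != 0 ->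
  (Lpnorm r%:E D (EFin \o h) = (\int[leb]_(x in D) (`|h x| `^ r)%:E) `^ r^-1)%E.
Proof.
move=> r0; rewrite -poweR_Lpnorm// -poweRrM mulfV// poweRe1//.
exact: Lnorm_ge0.
Qed.

Lemma integral_powR_lty r D u : (1 <= r) -> (Lpnorm r%:E D (EFin \o u) < +oo)%E ->
  (\int[leb]_(x in D) (`|u x| `^ r)%:E < +oo)%E.
Proof.
move=> r1; have r0 : 0 < r by exact: lt_le_trans r1.
rewrite Lpnorm_poweR ?gt_eqF// => /lty_poweRy; apply.
by rewrite invr_eq0 gt_eqF.
Qed.

Lemma itv_oo_split (t : R) : `]t - 1, t + 1[%classic = `]t - 1, t] `|` `]t, t + 1[ :> set R.
Proof. by rewrite -itv_bndbnd_setU// bnd_simp; lra. Qed.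

Lemma integral_setU_oo t (h : R -> \bar R) : (forall x, 0 <= h x)%E ->
  measurable_fun setT h ->
  (\int[leb]_(x in `](t - 1)%R, (t + 1)%R[) h x =
   \int[leb]_(x in `](t - 1)%R, t[) h x + \int[leb]_(x in `]t, (t + 1)%R[) h x)%E.
Proof.
move=> h0 mh; rewrite itv_oo_split ge0_integral_setU//=.
- congr (_ + _)%E; rewrite -integral_itv_bndo_bndc//.
  exact: measurable_funTS.
- exact: measurable_funTS.
- apply/disj_setPS => y [/=]; rewrite 2!in_itv/= => /andP[_ yx] /andP[].
  by rewrite ltNge yx.
Qed.

Lemma Lpnormy_scale D (c : R) (h : R -> R) : 0 <= c ->
  (Lpnorm +oo D (fun x => (c * h x)%:E) = c%:E * Lpnorm +oo D (EFin \o h))%E.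
Proof.
move=> c0; rewrite /Lpnorm unlock leb_setT_gt0 -ess_supZl ?leb_setT_gt0//.
congr ess_sup; apply/funext => x /=; rewrite !patchE; case: ifP => //= _.
  by rewrite normrM (ger0_norm c0) EFinM.
by rewrite normr0 mule0.
Qed.

Lemma Lpnormy_setU_oo t (h : R -> R) :
  (maxe (Lpnorm +oo `]t, (t + 1)%R[ (EFin \o h)) (Lpnorm +oo `](t - 1)%R, t[ (EFin \o h)) =
  Lpnorm +oo `](t - 1)%R, (t + 1)%R[ (EFin \o h))%E.
Proof.
apply/eqP; rewrite eq_le; apply/andP; split.
  rewrite ge_max; apply/andP; split; (apply: Lpnorm_ae_le; first exact: leey);
    apply: aeW => x; rewrite /= !in_itv/= => /andP[h1 h2]; split; rewrite ?lexx//;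
    by apply/andP; split; lra.
rewrite {1}/Lpnorm unlock leb_setT_gt0; apply/ess_supP.
have E D : {ae leb, forall x, (`|((EFin \o h) \_ D) x| <= Lpnorm +oo D (EFin \o h))%E}.
  by rewrite /Lpnorm unlock leb_setT_gt0; exact: (ess_sup_ge leb (abse \o ((EFin \o h) \_ D))).
apply: (aeS _ (ae_and (ae_neq t) (ae_and (E `]t, t + 1[%classic) (E `]t - 1, t[%classic)))) => x /= [xt [hx1 hx2]].
rewrite le_max patchE; case: ifPn => [|_]; last first.
  by rewrite abse0 Lnorm_ge0.
rewrite inE/= in_itv/= => /andP[x1 x2].
have [xt'|xt'|//] := ltgtP x t.
  by move: hx2; rewrite patchE mem_set/= ?in_itv/= ?x1// => ->; rewrite orbT.
by move: hx1; rewrite patchE mem_set/= ?in_itv/= ?x2 ?xt'// => ->.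
Qed.

Lemma Lpnormy_ae_le (D : set R) u (M : R) : (forall x, 0 <= u x) ->
  (Lpnorm +oo D (EFin \o u) <= M%:E)%E -> {ae leb, forall x, D x -> u x <= M}.
Proof.
move=> u0; rewrite /Lpnorm unlock leb_setT_gt0 => hM.
apply: (aeS _ (ess_sup_ge leb (abse \o ((EFin \o u) \_ D)))) => x hx Dx.
have := le_trans hx hM; rewrite /= patchE mem_set//= lee_fin.
by rewrite ger0_norm.
Qed.

Lemma ae_le_Lpnormy (D : set R) u (M : R) : (forall x, 0 <= u x) -> 0 <= M ->
  {ae leb, forall x, D x -> u x <= M} -> (Lpnorm +oo D (EFin \o u) <= M%:E)%E.
Proof.
move=> u0 M0 uM; rewrite /Lpnorm unlock leb_setT_gt0; apply/ess_supP.
apply: (aeS _ uM) => x ux; rewrite /= patchE; case: ifPn => [/set_mem/ux|_].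
  by rewrite /= lee_fin ger0_norm.
by rewrite abse0 lee_fin.
Qed.

Lemma Lpnorm_add p D u v : (1 <= p)%E -> measurable D ->
  measurable_fun setT u -> measurable_fun setT v ->
  (Lpnorm p D (EFin \o (u \+ v)%R) <=
   Lpnorm p D (EFin \o u) + Lpnorm p D (EFin \o v))%E.
Proof.
move=> p1 mD mu mv.
have mr (w : R -> R) : measurable_fun setT w -> measurable_fun setT (w \_ D).
  move=> mw; have := (measurable_restrictT w mD).1; apply.
  exact: measurable_funTS.
have E (w : R -> R) : (EFin \o w) \_ D = EFin \o (w \_ D).
  by apply/funext => x /=; rewrite !patchE; case: ifP.
have := eminkowski leb (mr _ mu) (mr _ mv) p1; rewrite /Lpnorm !E.
have -> : ((u \_ D) \+ (v \_ D))%R = (u \+ v) \_ D; last by [].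
by apply/funext => x /=; rewrite !patchE; case: ifP => //; rewrite addr0.
Qed.

Lemma Lpnorm_scale p D (c : R) u : (1 <= p)%E -> 0 <= c -> measurable D ->
  measurable_fun setT u ->
  (Lpnorm p D (EFin \o (fun x => c * u x)%R) = c%:E * Lpnorm p D (EFin \o u))%E.
Proof.
move=> + c0 mD mu; case: p => //= [r|_]; last exact: Lpnormy_scale.
rewrite lee_fin => r1; have r0 : 0 < r by exact: lt_le_trans r1.
have rn0 : r != 0 by rewrite gt_eqF.
rewrite !Lpnorm_poweR//.
have -> : c%:E = ((c `^ r)%:E `^ r^-1)%E.
  by rewrite poweR_EFin -powRrM mulfV// powRr1.
rewrite -poweRM ?lee_fin ?powR_ge0//; last first.
  by apply: integral_ge0 => x _; rewrite lee_fin powR_ge0.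
have mpow : measurable_fun D (fun x => (`|u x| `^ r)%:E).
  apply: measurable_funTS; apply/measurable_EFinP.
  by apply: (measurableT_comp (measurable_powR _)); exact: measurableT_comp.
have pow0 x : D x -> (0 <= (`|u x| `^ r)%:E)%E by rewrite lee_fin powR_ge0.
congr (_ `^ _)%E; rewrite -(ge0_integralZl_EFin leb mD pow0 mpow (powR_ge0 _ _)).
by apply: eq_integral => x _; rewrite normrM powRM// (ger0_norm c0).
Qed.

(** The interval has length 2, and 2 ^ (1 / r) <= 2. *)
Lemma Lpnorm_cst p (c : R) : (1 <= p)%E -> 0 <= c ->
  (Lpnorm p `](-1)%R, 1%R[ (EFin \o (fun=> c)) <= (2 * c)%:E)%E.
Proof.
move=> + c0; case: p => //= [r|_].
  rewrite lee_fin => r1; have r0 : 0 < r by exact: lt_le_trans r1.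
  have rn0 : r != 0 by rewrite gt_eqF.
  have leb2 : leb `](-1)%R, 1%R[%classic = 2%:E.
    by rewrite lebesgue_measure_itv/= lte_fin gtrN// -EFinD opprK.
  rewrite Lpnorm_poweR//= integral_cst// [X in (_ * X)%E]leb2.
  rewrite -EFinM poweR_EFin lee_fin (ger0_norm c0).
  rewrite powRM ?powR_ge0// -powRrM mulfV// powRr1// mulrC ler_wpM2r//.
  by rewrite -[leRHS]powRr1// ler_powR ?ler1n// invf_le1.
rewrite /Lpnorm unlock leb_setT_gt0; apply/ess_supP; apply: aeW => x.
rewrite /= patchE; case: ifP => _; last by rewrite abse0 lee_fin mulr_ge0.
by rewrite /= lee_fin (ger0_norm c0); lra.
Qed.

Lemma Lpnorm_dominated r D (u : nat -> R -> R) (M : R -> R) e :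
  1 <= r -> 0 < e -> measurable D -> (forall n, measurable_fun setT (u n)) ->
  measurable_fun setT M ->
  {ae leb, forall x, D x -> forall n, `|u n x| <= M x} ->
  {ae leb, forall x, D x -> u n x @[n --> \oo] --> 0} ->
  (Lpnorm r%:E D (EFin \o M) < +oo)%E ->
  \forall n \near \oo, (Lpnorm r%:E D (EFin \o u n) <= e%:E)%E.
Proof.
move=> r1 e0 mD mu mM uM u0 MD.
have r0 : 0 < r by exact: lt_le_trans r1.
have rn0 : r != 0 by rewrite gt_eqF.
have mpow (w : R -> R) : measurable_fun setT w ->
    measurable_fun D (fun x => (`|w x| `^ r)%:E).
  move=> mw; apply: measurable_funTS; apply/measurable_EFinP.
  by apply: (measurableT_comp (measurable_powR _)); exact: measurableT_comp.
have := @dominated_convergence _ _ _ leb D mD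
  (fun n x => (`|u n x| `^ r)%:E) (cst 0%E) (fun x => (`|M x| `^ r)%:E)
  (fun n => mpow _ (mu n)) (measurable_cst _).
case.
- apply: (aeS _ u0) => x u0x Dx; apply: cvg_EFin; first exact: nearW.
  rewrite /comp/=.
  have h := u0x Dx.
  have h' : `|u n x| @[n --> \oo] --> 0 by rewrite -(normr0 R); exact: cvg_norm.
  apply/cvgrPdist_lt => e' e'0.
  have e1 : 0 < e' `^ r^-1 by exact: powR_gt0.
  have : \forall n \near \oo, `|u n x| < e' `^ r^-1 by exact: (cvgr_lt _ h').
  apply: filterS => n un.
  rewrite sub0r normrN ger0_norm ?powR_ge0//.
  rewrite -[ltRHS]powRr1 ?ltW// -(@mulVf _ r)// powRrM.
  by apply: gt0_ltr_powR; rewrite ?nnegrE ?normr_ge0 ?powR_ge0.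
- apply/integrableP; split; first exact: mpow.
  apply: le_lt_trans (integral_powR_lty r1 MD).
  by under eq_integral do rewrite gee0_abs ?lee_fin ?powR_ge0//.
- apply: (aeS _ uM) => x uMx n Dx; rewrite gee0_abs ?lee_fin ?powR_ge0//.
  apply: ge0_ler_powR; rewrite ?nnegrE ?normr_ge0 ?(ltW r0)//.
  by rewrite (le_trans (uMx Dx n))// ler_norm.
move=> _ _; rewrite integral0 => /fine_cvgP[hfin /cvgrPdist_le].
have e1 : 0 < e `^ r by exact: powR_gt0.
move=> /(_ _ e1) hle; near=> n.
have fn : (\int[leb]_(x in D) (`|u n x| `^ r)%:E)%E \is a fin_num by near: n.
rewrite Lpnorm_poweR//.
have -> : e%:E = ((e `^ r)%:E `^ r^-1)%E.
  by rewrite poweR_EFin -powRrM mulfV// powRr1// ltW.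
apply: le_poweR; first by rewrite invr_ge0 ltW.
  by apply: integral_ge0 => x _; rewrite lee_fin powR_ge0.
rewrite -(fineK fn) lee_fin.
have : `|0 - fine (\int[leb]_(x in D) (`|u n x| `^ r)%:E)%E| <= e `^ r by near: n.
by rewrite sub0r normrN => /(le_trans (ler_norm _)).
Unshelve. all: by end_near. Qed.

Lemma Lpnorm_two_intervals p u (c t : R) : (1 <= p)%E ->
  measurable_fun setT u -> c <= t -> t <= c + 2 ->
  (Lpnorm p `](t - 1)%R, (t + 1)%R[ (EFin \o u) <=
   Lpnorm p `](c - 1)%R, (c + 1)%R[ (EFin \o u) +
   Lpnorm p `](c + 2 - 1)%R, (c + 2 + 1)%R[ (EFin \o u))%E.
Proof.
move=> p1 mu ct tc.
have mr (D : set R) : measurable D -> measurable_fun setT (u \_ D).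
  by move=> mD; have := (measurable_restrictT u mD).1; apply; exact: measurable_funTS.
have E (D : set R) : (EFin \o u) \_ D = EFin \o (u \_ D).
  by apply/funext => x /=; rewrite !patchE; case: ifP.
have := eminkowski leb (mr `]c - 1, c + 1[%classic (measurable_itv _))
  (mr `]c + 2 - 1, c + 2 + 1[%classic (measurable_itv _)) p1.
rewrite /Lpnorm !E; apply: le_trans; apply: Lnorm_ae_le => //.
apply: (aeS _ (ae_neq (c + 1))) => x xc /=; rewrite !patchE.
have [/set_mem|_] := boolP (x \in `]t - 1, t + 1[%classic); last first.
  by rewrite normr0 lee_fin normr_ge0.
rewrite /= in_itv/= => /andP[x1 x2].
have [xc'|xc'|//] := ltgtP x (c + 1).
  rewrite mem_set ?memNset ?addr0//=; rewrite in_itv/= ?xc'; last by lra.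
  by apply/negP; rewrite negb_and -leNgt; apply/orP; left; lra.
rewrite memNset; last first.
  by rewrite /= in_itv/=; apply/negP; rewrite negb_and -!leNgt; apply/orP; right; lra.
by rewrite mem_set ?add0r//= in_itv/=; lra.
Qed.

End norms.

(** * Primitives of locally integrable functions *)

Section primitives.
Context {R : realType}.
Local Notation leb := (@lebesgue_measure R).
Implicit Types (p : \bar R).

(** For a finite exponent r, |h| <= 1 + |h| ^ r and the interval has finite
    length. *)
Lemma Lp_integrable p (a b : R) (h : R -> R) : (1 <= p)%E ->
  measurable_fun setT h -> (Lpnorm p `]a, b[ (EFin \o h) < +oo)%E ->
  leb.-integrable `]a, b[ (EFin \o h).
Proof.
move=> + mh; set D := [set` `]a, b[].
have mD : measurable D by exact: measurable_itv.
have mhD : measurable_fun D (EFin \o h) by apply/measurable_EFinP; exact: measurable_funTS.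
have Dfin : (leb D < +oo)%E.
  by rewrite /D lebesgue_measure_itv/=; case: ifP => _; rewrite ?ltry.
rewrite /Lpnorm unlock; case: p => //= [r|_].
- rewrite lee_fin => r1; have r0 : 0 < r by exact: lt_le_trans r1.
  move=> /lty_poweRy; rewrite invr_eq0 gt_eqF// => /(_ isT) hfin.
  apply/integrableP; split => //.
  apply: (@le_lt_trans _ _ (\int[leb]_(x in D) (1 + (`|h x| `^ r)%:E))%E).
    apply: ge0_le_integral => //=.
    + apply/measurable_EFinP; apply: (measurable_funS measurableT) => //.
      exact: measurableT_comp.
    + apply: emeasurable_funD => //; apply/measurable_EFinP.
      apply: (measurable_funS measurableT) => //.
      by apply: (measurableT_comp (measurable_powR _)); exact: measurableT_comp.
    + move=> x _; rewrite -EFinD lee_fin.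
      have [h1|/ltW h1] := leP `|h x| 1.
        by rewrite (le_trans h1)// lerDl powR_ge0.
      rewrite (@le_trans _ _ (`|h x| `^ r))// ?lerDr//.
      by rewrite -[leLHS]powRr1// ler_powR.
  rewrite ge0_integralD//=; last first.
    apply/measurable_EFinP; apply: (measurable_funS measurableT) => //.
    by apply: (measurableT_comp (measurable_powR _)); exact: measurableT_comp.
  rewrite integral_cst// mul1e lte_add_pinfty//.
  rewrite integral_mkcond; apply: le_lt_trans hfin; apply: ge0_ae_le_integral.
  + by move=> x; rewrite patchE; case: ifP => // _; rewrite lee_fin powR_ge0.
  + by move=> x; exact: poweR_ge0.
  + by apply: aeW => x; rewrite !patchE; case: ifP => //= _; rewrite lee_fin powR_ge0.
- rewrite leb_setT_gt0 => hfin.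
  set M := ess_sup _ _ in hfin.
  have M0 : (0 <= M)%E.
    by apply: ess_sup_gee; [exact: leb_setT_gt0|apply: aeW => x; exact: abse_ge0].
  apply/integrableP; split => //.
  have hM : {ae leb, forall x, D x -> (`|(EFin \o h) x| <= M)%E}.
    apply: (aeS _ (ess_sup_ge leb (abse \o ((EFin \o h) \_ D)))) => x /= + Dx.
    by rewrite patchE mem_set.
  apply: le_lt_trans (@integral_le_bound _ _ _ leb _ _ M mD mhD M0 hM) _.
  by rewrite lte_mul_pinfty// ge0_fin_numE.
Qed.

(** A derivative v <> 0 at a zero t of H forces H to be nonzero on an interval
    ]t, t + e[, which is not negligible. *)
Lemma derive_ae_zero (H : R -> R) : {ae leb, forall t, 0 < t -> H t = 0} ->
  {ae leb, forall t : R, 0 < t -> forall v : R, is_derive t 1 H v -> v = 0}.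
Proof.
move=> [N [mN N0 HN]]; exists N; split => // t /= /not_implyP[t0 Ht].
apply: contrapT => Nt; apply: Ht => v [dH vH].
have H0 s : 0 < s -> ~ N s -> H s = 0.
  by move=> s0 Ns; apply: contrapT => Hs; apply: Ns; apply: HN => /= /(_ s0).
apply: contrapT => v0.
have : (fun h => h^-1 *: ((H \o shift t) (h *: 1) - H t)) @ 0^' --> v.
  by rewrite -vH; exact: dH.
move=> /cvgr_dist_lt /(_ `|v|); rewrite normr_gt0 => /(_ (introN eqP v0)).
move=> [e /= e0 he].
have sub : `]t, t + e[ `<=` N.
  move=> s /=; rewrite in_itv/= => /andP[ts ste].
  apply: contrapT => Ns.
  have := he (s - t).
  rewrite /= /ball_/= sub0r normrN gtr0_norm ?subr_gt0// => /(_ _ _).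
  rewrite ltrBlDl => /(_ ste); rewrite gt_eqF ?subr_gt0// => /(_ isT).
  rewrite /GRing.scale/= mulr1 subrK (H0 s) ?(lt_trans t0)// (H0 t)//.
  by rewrite subr0 mulr0 subr0 ltxx.
have : (leb `]t, (t + e)%R[ <= leb N)%E by apply: le_measure => //; rewrite inE.
by rewrite N0 lebesgue_measure_itv/= lte_fin ltrDl e0 -EFinD addrAC subrr add0r lee_fin leNgt e0.
Qed.

Lemma is_derive_of (F : R -> R) (x v : R) : derivable F x 1 /\ derive1 F x = v ->
  is_derive x 1 F v.
Proof. by move=> [dF <-]; split => //; rewrite derive1E. Qed.

Variable h : R -> R.
Hypothesis mh : measurable_fun setT h.
Hypothesis h0 : forall x, x <= -1 -> h x = 0.
Hypothesis ih : forall T : R, leb.-integrable `]-1, T[ (EFin \o h).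

(** The base point is -1 because g is given on ]-1, +oo[. *)
Definition primitive (y : R) : R := \int[leb]_(x in `]-1, y]) h x.

Lemma integrable_oc y : leb.-integrable `]-1, y] (EFin \o h).
Proof.
apply: (@integrableS _ _ _ leb `]-1, (y + 1)[) => // x /=.
by rewrite !in_itv/= => /andP[-> xy]; rewrite (le_lt_trans xy)// ltrDl.
Qed.

Lemma primitive_derive :
  {ae leb, forall x, -1 < x ->
    derivable primitive x 1 /\ derive1 primitive x = h x}.
Proof.
have loc : locally_integrable setT h.
  split => //; first exact: openT.
  move=> K _ /compact_bounded [M [_ /(_ (M + 1))]].
  rewrite ltrDl => /(_ ltr01) KM.
  have /integrableP[_] := ih (M + 1 + 1).
  apply: le_lt_trans.
  rewrite integral_mkcond [leRHS]integral_mkcond; apply: ge0_ae_le_integral.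
  - by move=> x; rewrite patchE; case: ifP.
  - by move=> x; rewrite patchE; case: ifP.
  - apply: aeW => x; rewrite !patchE; case: ifPn => // [/set_mem Kx|_]; last first.
      by case: ifP => // _; exact: abse_ge0.
    have xM := KM x Kx; case: ifPn => //=.
    rewrite notin_setE/= in_itv/= => /negP; rewrite negb_and -!leNgt => /orP[/h0 ->|].
      by rewrite normr0.
    have : x <= M + 1 by apply: le_trans (ler_norm _) xM.
    by move=> ? ?; exfalso; lra.
have := @FTC1 R h (BRight (-1)) integrable_oc loc.
by apply: aeS => x hx x1; apply: hx. 
Qed.

(** The integral only sees h between 0 and y.  This lets the lemma apply also
    to f, which is given on ]0, +oo[ only. *)
Lemma integral_from0_primitive (g : R -> R) y : -1 < y ->
  {ae leb, forall x, Num.min 0 y <= x -> h x = g x} ->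
  integral_from0 g y = primitive y - primitive 0.
Proof.
move=> y1 hg; rewrite /integral_from0; case: ifPn => y0.
  have m10 : (BRight (-1) <= BRight 0 :> itv_bound R)%O by rewrite bnd_simp lerN10.
  have ?: (BRight 0 <= BRight y :> itv_bound R)%O by rewrite bnd_simp.
  rewrite (Rintegral_itvB (integrable_oc y))//.
  rewrite Rintegral_itv_obnd_cbnd; last first.
    apply: integrableS (integrable_oc y) => // x /=; rewrite !in_itv/=.
    by move=> /andP[x0 ->]; rewrite (lt_trans _ x0).
  apply/esym/Rintegral_ae_eq; apply: (aeS _ hg) => x hgx /=.
  by rewrite in_itv/= => /andP[x0 _]; apply: hgx; rewrite ge_min x0.
move: y0; rewrite -ltNge => y0; rewrite -opprB; congr (- _).
have m1y : (BRight (-1) <= BRight y :> itv_bound R)%O by rewrite bnd_simp ltW.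
have ?: (BRight y <= BRight 0 :> itv_bound R)%O by rewrite bnd_simp ltW.
rewrite (Rintegral_itvB (integrable_oc 0))//.
  rewrite Rintegral_itv_obnd_cbnd; last first.
    apply: integrableS (integrable_oc 0) => // x /=; rewrite !in_itv/=.
    by move=> /andP[x0 ->]; rewrite (lt_trans _ x0).
  apply/esym/Rintegral_ae_eq; apply: (aeS _ hg) => x hgx /=.
  by rewrite in_itv/= => /andP[x0 _]; apply: hgx; rewrite ge_min x0 ?orbT.
Qed.

End primitives.

(** * d'Alembert's formula and the energy *)

Section wave_profile.
Context {R : realType}.
Local Notation leb := (@lebesgue_measure R).

Variables (f g f' g' : R -> R) (z : R -> R -> R).
Hypotheses (mf' : measurable_fun setT f') (mg' : measurable_fun setT g').
Hypotheses (f'0 : forall x, x <= -1 -> f' x = 0)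
           (g'0 : forall x, x <= -1 -> g' x = 0).
Hypotheses (if' : forall T : R, leb.-integrable `]-1, T[ (EFin \o f'))
           (ig' : forall T : R, leb.-integrable `]-1, T[ (EFin \o g')).
Hypotheses (f'f : {ae leb, forall x, 0 < x -> f' x = f x})
           (g'g : {ae leb, forall x, -1 < x -> g' x = g x}).
Hypothesis zE : forall t x : R, 0 <= t -> 0 <= x <= 1 ->
        z t x = integral_from0 f (t + x) / Num.sqrt 2 +
                integral_from0 g (t - x) / Num.sqrt 2.

Lemma wave_primitiveE t x : 0 <= t -> 0 <= x <= 1 -> x < 1 ->
  z t x = (primitive f' (t + x) - primitive f' 0) / Num.sqrt 2 +
          (primitive g' (t - x) - primitive g' 0) / Num.sqrt 2.
Proof.
move=> t0 x01 x1; rewrite zE//.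
have /andP[x0 _] := x01.
rewrite (integral_from0_primitive if' (g := f)); last 2 first.
- by lra.
- apply: (aeS _ (ae_and (ae_neq 0) f'f)) => y [/eqP y0 f'y].
  by rewrite min_l ?addr_ge0// le_eqVlt eq_sym (negbTE y0); exact: f'y.
rewrite (integral_from0_primitive ig' (g := g))//; first by lra.
apply: (aeS _ g'g) => y g'y; rewrite ge_min => /orP[?|?]; apply: g'y; lra.
Qed.

(** The sum of the two primitives vanishes almost everywhere, so does its
    derivative. *)
Lemma dirichlet_reflection : {ae leb, forall t, 0 <= t -> z t 0 = 0} ->
  {ae leb, forall t, 0 < t -> f' t = - g' t}.
Proof.
move=> z0.
pose H t := (primitive f' t - primitive f' 0) + (primitive g' t - primitive g' 0).
have : {ae leb, forall t, 0 < t -> H t = 0}.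
  apply: (aeS _ z0) => t zt t0; move: (zt (ltW t0)).
  rewrite wave_primitiveE ?(ltW t0) ?lexx ?ler01// addr0 subr0 -mulrDl => /eqP.
  by rewrite mulf_eq0 invr_eq0 sqrtr_eq0 leNgt ltr0n orbF => /eqP.
move=> /derive_ae_zero hH.
have hf := primitive_derive mf' f'0 if'.
have hg := primitive_derive mg' g'0 ig'.
apply: (aeS _ (ae_and hH (ae_and hf hg))) => t [Ht [ft gt]] t0.
have t1 : -1 < t by lra.
have := Ht t0 ((f' t - 0) + (g' t - 0)).
rewrite !subr0 => h; apply/eqP; rewrite -addr_eq0; apply/eqP; apply: h.
have Df := is_derive_of (ft t1); have Dg := is_derive_of (gt t1).
rewrite -[f' t]subr0 -[g' t]subr0; rewrite /H.
exact: is_deriveD.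
Qed.

Lemma space_derivative t : 0 <= t ->
  {ae leb, forall x, 0 < x < 1 ->
    derive1 (z t) x = (f' (t + x) - g' (t - x)) / Num.sqrt 2}.
Proof.
move=> t0.
have hf := leb_preserving_ae (leb_preserving_addr t) (primitive_derive mf' f'0 if').
have hg := leb_preserving_ae (leb_preserving_subl t) (primitive_derive mg' g'0 ig').
apply: (aeS _ (ae_and hf hg)) => x [fx gx] /andP[x0 x1].
have Df : is_derive (t + x) 1 (primitive f') (f' (t + x)).
  by apply: is_derive_of; rewrite addrC; apply: fx; lra.
have Dg : is_derive (t - x) 1 (primitive g') (g' (t - x)).
  by apply: is_derive_of; apply: gx; lra.
pose K (y : R) := (primitive f' (t + y) - primitive f' 0) / Num.sqrt 2 +
          (primitive g' (t - y) - primitive g' 0) / Num.sqrt 2.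
have zK : \forall y \near x, z t y = K y.
  near=> y.
  have [y0 y1] : 0 < y /\ y < 1 by split; near: y; [exact: lt_nbhsr|exact: lt_nbhsl].
  by rewrite wave_primitiveE// (ltW y0) (ltW y1).
rewrite derive1E (near_eq_derive _ zK).
have Dtp : is_derive x 1 (fun y : R => t + y) 1.
  by rewrite -[X in is_derive _ _ _ X]add0r; exact: is_deriveD.
have Dtm : is_derive x 1 (fun y : R => t - y) (-1).
  by rewrite -[X in is_derive _ _ _ X]add0r; exact: is_deriveD.
have D1 := @is_derive1_comp _ (primitive f') (fun y : R => t + y) x _ _ Df Dtp.
have D2 := @is_derive1_comp _ (primitive g') (fun y : R => t - y) x _ _ Dg Dtm.
have DA := is_deriveB D1 (is_derive_cst (primitive f' 0) x 1).
have DB := is_deriveB D2 (is_derive_cst (primitive g' 0) x 1).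
have DK := is_deriveZ ((Num.sqrt 2)^-1 : R) (is_deriveD DA DB).
have -> : K = (Num.sqrt 2)^-1 \*: (((primitive f' \o (fun y : R => t + y)) - cst (primitive f' 0))
  + ((primitive g' \o (fun y : R => t - y)) - cst (primitive g' 0))).
  by apply/funext => y /=; rewrite /K /GRing.scale/= -mulrDl mulrC.
rewrite (@derive_val _ _ _ _ _ _ _ DK) /GRing.scale/= mulrC; congr (_ * _).
by rewrite !subr0 mulr1 mulrN1.
Unshelve. all: by end_near. Qed.

End wave_profile.

Section energy.
Context {R : realType}.
Local Notation leb := (@lebesgue_measure R).
Implicit Types (p : \bar R).

Lemma sqrt2_gt0 : 0 < Num.sqrt 2 :> R.
Proof. by rewrite sqrtr_gt0. Qed.

Lemma sqrt2K : Num.sqrt 2 * Num.sqrt 2 = 2 :> R.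
Proof. by rewrite -expr2 sqr_sqrtr. Qed.

(** With a = f (t + x) and b = g (t - x), the left-hand sides are z_x + z_t and
    z_x - z_t. *)
Lemma riemann_invariants (a b : R) :
  (a - b) / Num.sqrt 2 + (a + b) / Num.sqrt 2 = Num.sqrt 2 * a /\
  (a - b) / Num.sqrt 2 - (a + b) / Num.sqrt 2 = - (Num.sqrt 2 * b).
Proof.
have s0 : Num.sqrt 2 != 0 :> R by rewrite gt_eqF// sqrt2_gt0.
have E : Num.sqrt 2 / 2 = (Num.sqrt 2)^-1 :> R.
  by rewrite -{2}sqrt2K invfM mulrA mulfV// mul1r.
by rewrite -E; split; field.
Qed.

(** Both Riemann invariants are values of the single function g', at t + x and
    at t - x; these points sweep ]t, t + 1[ and ]t - 1, t[, and the factor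
    sqrt 2 cancels the normalization of the norm. *)
Lemma energyE p (z : R -> R -> R) (f g g' : R -> R) t : (1 <= p)%E -> measurable_fun setT g' ->
  {ae leb, forall x, 0 < x < 1 ->
    derive1 (z t) x = (f (t + x) - g (t - x)) / Num.sqrt 2} ->
  {ae leb, forall x, 0 < x < 1 -> f (t + x) = - g' (t + x)} ->
  {ae leb, forall x, 0 < x < 1 -> g (t - x) = g' (t - x)} ->
  energy p z f g t = Lpnorm p `](t - 1), (t + 1)[ (EFin \o g').
Proof.
move=> p1 mg' hd hf hg.
have inv : {ae leb, forall x, 0 < x < 1 ->
    derive1 (z t) x + wave_t f g t x = - (Num.sqrt 2 * g' (t + x)) /\
    derive1 (z t) x - wave_t f g t x = - (Num.sqrt 2 * g' (t - x))}.
  apply: (aeS _ (ae_and hd (ae_and hf hg))) => x [hdx [hfx hgx]] x01.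
  have [E1 E2] := riemann_invariants (f (t + x)) (g (t - x)).
  by rewrite hdx// /wave_t E1 E2 hfx// hgx// mulrN.
have p01 : (fun x => t + x) @^-1` `]t, t + 1[ = `]0, 1[%classic :> set R.
  by apply/seteqP; split => x /=; rewrite !in_itv/= ltrDl ltrD2l.
have m01 : (fun x => t - x) @^-1` `]t - 1, t[ = `]0, 1[%classic :> set R.
  by apply/seteqP; split => x /=; rewrite !in_itv/= ltrD2l ltrN2 gtrBl andbC.
have pD : leb_preserving (fun x : R => t + x).
  by under eq_fun do rewrite addrC; exact: leb_preserving_addr.
have NR q : (1 <= q)%E -> Lpnorm q `]0, 1[ (EFin \o (g' \o (fun x => t + x))) =
    Lpnorm q `]t, t + 1[ (EFin \o g').
  move=> q1; rewrite -p01; apply: (Lpnorm_preserving _ pD (leb_preserving_addr (- t))) => //.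
  by move=> x; rewrite addrC subrK.
have NL q : (1 <= q)%E -> Lpnorm q `]0, 1[ (EFin \o (g' \o (fun x => t - x))) =
    Lpnorm q `]t - 1, t[ (EFin \o g').
  move=> q1; rewrite -m01; apply: (Lpnorm_preserving _ (leb_preserving_subl t) (leb_preserving_subl t)) => //.
  by move=> x; rewrite opprB addrC subrK.
rewrite /energy /Xnorm; move: p1; case: p => //= [r|_].
  rewrite lee_fin => r1; have r0 : 0 < r by exact: lt_le_trans r1.
  have rn0 : r != 0 by rewrite gt_eqF.
  have mpow (T : R -> R) : measurable_fun setT T ->
      measurable_fun setT (fun x => (`|g' (T x)| `^ r)%:E).
    move=> mT; apply/measurable_EFinP; apply: (measurableT_comp (measurable_powR _)).
    by apply: measurableT_comp => //; exact: (measurableT_comp mg' mT).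
  rewrite Lpnorm_poweR//; congr (_ `^ _)%E.
  rewrite integral_setU_oo; last 2 first.
  - by move=> x; rewrite lee_fin powR_ge0.
  - exact: mpow.
  rewrite -!poweR_Lpnorm// -NR -?NL ?lee_fin// !poweR_Lpnorm//=.
  (* The weight 2 ^ (- r / 2) of the norm undoes this factor. *)
  have s0 : 0 < Num.sqrt 2 `^ r :> R by rewrite powR_gt0// sqrt2_gt0.
  rewrite (@ge0_ae_eq_integral_on _ _ _ (fun x => (Num.sqrt 2 `^ r)%:E *
     ((`|g' (t - x)| `^ r)%:E + (`|g' (t + x)| `^ r)%:E))%E).
  - have m1 : measurable_fun (`]0, 1[%classic : set R) (fun x : R => (`|g' (t - x)| `^ r)%:E).
      by apply: measurable_funTS; apply: mpow; exact: (leb_preserving_subl t).1.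
    have m2 : measurable_fun (`]0, 1[%classic : set R) (fun x : R => (`|g' (t + x)| `^ r)%:E).
      by apply: measurable_funTS; apply: mpow; exact: pD.1.
    have n1 x : (`]0, 1[%classic : set R) x -> (0 <= (`|g' (t - x)| `^ r)%:E)%E.
      by rewrite lee_fin powR_ge0.
    have n2 x : (`]0, 1[%classic : set R) x -> (0 <= (`|g' (t + x)| `^ r)%:E)%E.
      by rewrite lee_fin powR_ge0.
    have m12 := emeasurable_funD m1 m2.
    rewrite ge0_integralZl_EFin ?(ltW s0)//; last by move=> x x01; rewrite adde_ge0 ?n1 ?n2.
    rewrite ge0_integralD// muleA -EFinM.
    have -> : 2 `^ (- (r / 2)) * Num.sqrt 2 `^ r = 1 :> R.
      rewrite -powR12_sqrt// -powRrM powRN [2^-1 * r]mulrC mulVf ?gt_eqF ?powR_gt0//.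
    by rewrite mul1e.
  - by move=> x; rewrite lee_fin addr_ge0// powR_ge0.
  - by move=> x; rewrite -EFinD -EFinM lee_fin mulr_ge0 ?addr_ge0 ?powR_ge0.
  - apply: (aeS _ inv) => x /= invx; rewrite in_itv/= => x01.
    have [-> ->] := invx x01.
    rewrite -EFinD -EFinM !normrN !normrM !powRM//.
    by rewrite (ger0_norm (sqrtr_ge0 2)) -mulrDr addrC.
have y1 : (1 <= +oo :> \bar R)%E by exact: leey.
have E1 : Lpnorm +oo `]0, 1[ (fun x => (derive1 (z t) x + wave_t f g t x)%:E) =
   ((Num.sqrt 2)%:E * Lpnorm +oo `]t, (t + 1)%R[ (EFin \o g'))%E.
  rewrite -NR// -Lpnormy_scale ?sqrtr_ge0//; apply: Lpnorm_ae_eq => //.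
  apply: (aeS _ inv) => x /= invx; rewrite in_itv/= => x01.
  by have [-> _] := invx x01; rewrite normrN.
have E2 : Lpnorm +oo `]0, 1[ (fun x => (derive1 (z t) x - wave_t f g t x)%:E) =
   ((Num.sqrt 2)%:E * Lpnorm +oo `](t - 1)%R, t[ (EFin \o g'))%E.
  rewrite -NL// -Lpnormy_scale ?sqrtr_ge0//; apply: Lpnorm_ae_eq => //.
  apply: (aeS _ inv) => x /= invx; rewrite in_itv/= => x01.
  by have [_ ->] := invx x01; rewrite normrN.
rewrite E1 E2 -maxe_pMr ?lee_fin ?sqrtr_ge0// muleA -EFinM mulVf ?gt_eqF ?sqrt2_gt0// mul1e.
exact: Lpnormy_setU_oo.
Qed.

Lemma energy_ge0 (p : \bar R) z f g t : (0 <= energy p z f g t :> \bar R)%E.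
Proof.
rewrite /energy /Xnorm; case: p => [r| |//]; first exact: poweR_ge0.
by rewrite mule_ge0 ?lee_fin ?invr_ge0 ?sqrtr_ge0// le_max Lnorm_ge0.
Qed.

End energy.

(** * The delay relation at the boundary *)

(** G and delta stand for the moduli of g and of the disturbance: the boundary
    condition at x = 1 in rotated coordinates says that g (t + 1) is, up to the
    disturbance, in the image under S of g (t - 1) moved by the disturbance. *)
Definition delay_relation {R : realType} (Sigma : set (R * R)) (G delta : R -> R) : Prop :=
  {ae @lebesgue_measure R, forall t, 0 <= t -> exists x y,
    [/\ (rotation @` Sigma) (x, y), `|x| <= G (t - 1) + delta t &
        G (t + 1) <= `|y| + delta t]}.

Section profile.
Context {R : realType}.
Local Notation leb := (@lebesgue_measure R).
Implicit Types (p : \bar R).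

Lemma Lploc_borel p (a : R) (f : R -> R) : (1 <= p)%E -> -1 <= a -> Lploc p a f ->
  exists h : R -> R, [/\ measurable_fun setT h, forall x, x <= a -> h x = 0,
    {ae leb, forall x, a < x -> h x = f x} &
    forall T : R, (Lpnorm p `](-1)%R, T[ (EFin \o h) < +oo)%E].
Proof.
move=> p1 a1 fL.
(* The completed sigma-algebra is closed under the union over n of the
   bounded intervals ]a, a + n + 1[. *)
have mf : lebesgue_measurable_fun `]a, +oo[ f.
  move=> Y mY.
  have -> : `]a, +oo[ `&` f @^-1` Y = \bigcup_n (`]a, a + n.+1%:R[ `&` f @^-1` Y).
    rewrite -setI_bigcupl; congr (_ `&` _).
    apply/seteqP; split => [x /=|x [n _] /=]; rewrite !in_itv/= ?andbT; last by case/andP.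
    move=> ax; exists (Num.truncn (x - a)) => //=; rewrite in_itv/= ax/=.
    by rewrite -ltrBlDl Num.Theory.truncnS_gt.
  apply: completed_algebra_bigcup => n; apply: (fL _ _).1 => //.
  by rewrite ltrDl.
have [h [mh h0 hf]] := borel_representative (measurable_itv _) mf.
exists h; split => //.
- by move=> x xa; apply: h0; rewrite /= in_itv/= andbT ltNge xa.
- by apply: (aeS _ hf) => x hx ax; apply: hx; rewrite /= in_itv/= ax.
move=> T; pose T' := Num.max T (a + 1).
have aT' : a < T' by rewrite /T' lt_max ltrDl ltr01 orbT.
apply: le_lt_trans (fL _ aT').2; apply: Lnorm_ae_le => //.
apply: (aeS _ hf) => x hx; rewrite !patchE; case: ifPn => [|_]; last by rewrite abse0 abse_ge0.
rewrite inE/= in_itv/= => /andP[x1 xT].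
have [ax|xa] := ltP a x.
  rewrite mem_set/= ?in_itv/= ?ax ?lt_max ?xT//.
  by rewrite hx//= in_itv/= ax.
by rewrite h0 ?normr0 ?abse_ge0//= in_itv/= andbT ltNge xa.
Qed.

Lemma measurable_enorm : measurable_fun setT (@enorm R).
Proof.
have m1 : measurable_fun setT (fun v : R * R => v.1 ^+ 2 + v.2 ^+ 2).
  by apply: measurable_funD; apply: measurable_funX.
apply: (measurableT_comp _ m1).
exact: continuous_measurable_fun (@sqrt_continuous R).
Qed.

(** The rotation is an isometry: the two quotients are the moduli of the
    coordinates of the rotated vector. *)
Lemma rotation_le_enorm (v : R * R) : `|v.1 + v.2| / Num.sqrt 2 <= enorm v /\
  `|- v.1 + v.2| / Num.sqrt 2 <= enorm v.
Proof.
have key (a b : R) : `|a + b| / Num.sqrt 2 <= Num.sqrt (a ^+ 2 + b ^+ 2).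
  rewrite ler_pdivrMr ?sqrt2_gt0// -sqrtrM ?addr_ge0 ?sqr_ge0// -sqrtr_sqr.
  rewrite ler_wsqrtr// -subr_ge0 (_ : _ - _ = (a - b) ^+ 2) ?sqr_ge0//.
  by ring.
split; first exact: key.
by have := key (- v.1) v.2; rewrite sqrrN.
Qed.

(** The rotation maps the boundary value to (b, - a); its point in the rotated
    Sigma is (b, - a) minus the rotated v. *)
Lemma boundary_relation (Sigma : set (R * R)) (v : R * R) (a b : R) :
  translate Sigma v ((a + b) / Num.sqrt 2, - ((a - b) / Num.sqrt 2)) ->
  exists x y, [/\ (rotation @` Sigma) (x, y), `|x| <= `|b| + enorm v &
    `|a| <= `|y| + enorm v].
Proof.
move=> [xi Sxi [E1 E2]].
have [h1 h2] := rotation_le_enorm v.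
have s0 : 0 < Num.sqrt 2 :> R by exact: sqrt2_gt0.
have sn0 : Num.sqrt 2 != 0 :> R by rewrite gt_eqF.
have S2 : Num.sqrt 2 * Num.sqrt 2 = 2 :> R by exact: sqrt2K.
have half (u : R) : 2 * u / Num.sqrt 2 / Num.sqrt 2 = u.
  by rewrite -[LHS]mulrA -invfM S2 mulrAC mulfV// mul1r.
have Ex : (xi.1 + xi.2) / Num.sqrt 2 = b - (v.1 + v.2) / Num.sqrt 2.
  rewrite (_ : xi.1 + xi.2 = (2 * b) / Num.sqrt 2 - (v.1 + v.2)).
    by rewrite mulrBl half.
  have -> : xi.1 + xi.2 = (xi.1 + v.1) + (xi.2 + v.2) - (v.1 + v.2) by ring.
  by rewrite E1 E2; field.
have Ey : (- xi.1 + xi.2) / Num.sqrt 2 = - a - (- v.1 + v.2) / Num.sqrt 2.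
  rewrite (_ : - xi.1 + xi.2 = 2 * (- a) / Num.sqrt 2 - (- v.1 + v.2)).
    by rewrite mulrBl half.
  have -> : - xi.1 + xi.2 = - (xi.1 + v.1) + (xi.2 + v.2) - (- v.1 + v.2) by ring.
  by rewrite E1 E2; field.
exists ((xi.1 + xi.2) / Num.sqrt 2), ((- xi.1 + xi.2) / Num.sqrt 2); split.
- by exists xi.
- rewrite Ex (le_trans (ler_normB _ _))// lerD2l.
  by rewrite normrM normfV (gtr0_norm s0).
- have -> : a = - ((- xi.1 + xi.2) / Num.sqrt 2 + (- v.1 + v.2) / Num.sqrt 2).
    by rewrite Ey subrK opprK.
  rewrite normrN (le_trans (ler_normD _ _))// lerD2l.
  by rewrite normrM normfV (gtr0_norm s0).
Qed.

Lemma solution_profile p (Sigma : set (R * R)) d z0 z1 z f g :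
  (1 <= p)%E -> lebesgue_measurable_fun `[0, +oo[ d ->
  solution p Sigma d z0 z1 z f g ->
  exists G delta : R -> R,
  [/\ [/\ measurable_fun setT G, measurable_fun setT delta,
          forall x, 0 <= G x & forall x, 0 <= delta x],
      forall T : R, (Lpnorm p `](-1)%R, T[ (EFin \o G) < +oo)%E,
      {ae leb, forall t, 0 <= t -> delta t = enorm (d t)},
      forall t : R, 0 <= t -> energy p z f g t = Lpnorm p `]t - 1, t + 1[ (EFin \o G) &
      delay_relation Sigma G delta].
Proof.
move=> p1 md [[fL gL] zE hae _].
have [f' [mf' f'0 f'f if']] := Lploc_borel p1 (lerN10 R) fL.
have [g' [mg' g'0 g'g ig']] := Lploc_borel p1 (lexx (-1)) gL.
have mnd : lebesgue_measurable_fun `[0, +oo[ (fun t => enorm (d t)).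
  move=> Y mY; apply: (md (@enorm R @^-1` Y)).
  by rewrite -[X in measurable X]setTI; exact: measurable_enorm.
have [del [mdel del0 hdel]] := borel_representative (measurable_itv _) mnd.
have {}hdel : {ae leb, forall t, 0 <= t -> del t = enorm (d t)}.
  by apply: (aeS _ hdel) => t ht t0; apply: ht; rewrite /= in_itv/= t0.
have f'0' x : x <= -1 -> f' x = 0 by move=> x1; apply: f'0; lra.
have iif T := Lp_integrable p1 mf' (if' T).
have iig T := Lp_integrable p1 mg' (ig' T).
have fg : {ae leb, forall t, 0 < t -> f' t = - g' t}.
  apply: (dirichlet_reflection mf' mg' f'0' g'0 iif iig f'f g'g zE).
  by apply: (aeS _ hae) => t ht /ht[].
have ffg : {ae leb, forall t, 0 < t -> f t = - g' t}.
  by apply: (aeS _ (ae_and f'f fg)) => t [ht1 ht2] t0; rewrite -ht1// ht2.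
exists (fun x => `|g' x|), (fun x => `|del x|); split.
- split => //.
  + exact: measurableT_comp.
  + exact: measurableT_comp.
- move=> T; apply: le_lt_trans (ig' T); apply: Lpnorm_ae_le => //.
  by apply: aeW => x; rewrite /= normr_id.
- by apply: (aeS _ hdel) => t ht t0; rewrite ht// ger0_norm// sqrtr_ge0.
- move=> t t0; rewrite (energyE p1 mg' _ _ _).
  + apply: Lpnorm_ae_eq => //.
    by apply: aeW => x; rewrite /= normr_id.
  + have hd := space_derivative mf' mg' f'0' g'0 iif iig f'f g'g zE t0.
    have h1 := leb_preserving_ae (leb_preserving_addr t) f'f.
    have h2 := leb_preserving_ae (leb_preserving_subl t) g'g.
    apply: (aeS _ (ae_and hd (ae_and h1 h2))) => x [hdx [h1x h2x]] /andP[x0 x1].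
    by rewrite hdx ?x0// [t + x]addrC h1x ?h2x//; lra.
  + apply: (aeS _ (leb_preserving_ae (leb_preserving_addr t) ffg)) => x hx /andP[x0 x1].
    by rewrite [t + x]addrC hx//; lra.
  + apply: (aeS _ (leb_preserving_ae (leb_preserving_subl t) g'g)) => x hx /andP[x0 x1].
    by rewrite hx//; lra.
- have h1 := leb_preserving_ae (leb_preserving_addr 1) ffg.
  have h2 := leb_preserving_ae (leb_preserving_addr (-1)) g'g.
  apply: (aeS _ (ae_and (ae_and (ae_neq 0) hdel) (ae_and (ae_and h1 h2) hae))).
  move=> t [[/eqP tn0 ht] [[h1t h2t] haet]] t0.
  have [_ tr] := haet t0.
  have t0' : 0 < t by rewrite lt_neqAle eq_sym tn0.
  have [x [y [Sxy hx hy]]] := boundary_relation tr.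
  exists x, y; split => //.
  + by rewrite ht// (ger0_norm (sqrtr_ge0 _)) h2t//; lra.
  + move: hy; rewrite h1t; last by lra.
    by rewrite normrN ht// (ger0_norm (sqrtr_ge0 _)).
Qed.

End profile.

(** * The gain function and the scalar recursion *)

Definition gain {R : realType} (S : R -> set R) (mu : R -> R) : Prop :=
  forall r : R, 0 <= r ->
    ereal_sup [set setnorm (S x) | x in [set x : R | `|x| <= r + eta]]
      @[eta --> (0 : R)^'+] --> (mu r)%:E.

Section gain.
Context {R : realType}.
Variables (S : R -> set R) (mu : R -> R).
Hypothesis hmu : gain S mu.

Lemma mu_ub r x y : 0 <= r -> `|x| <= r -> S x y -> `|y| <= mu r.
Proof.
move=> r0 xr Sxy; rewrite -lee_fin.
apply: (cvge_ge _ (hmu r0)); near=> eta.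
have eta0 : 0 < eta by near: eta; exact: nbhs_right_gt.
apply: (@le_trans _ _ (setnorm (S x))).
  by apply: ereal_sup_ubound; exists y.
by apply: ereal_sup_ubound; exists x => //=; rewrite (le_trans xr)// lerDl ltW.
Unshelve. all: by end_near. Qed.

Lemma mu_le r eta K : 0 <= r -> 0 < eta ->
  (forall x y, `|x| <= r + eta -> S x y -> `|y| <= K) -> mu r <= K.
Proof.
move=> r0 eta0 SK; rewrite -lee_fin.
apply: (cvge_le _ (hmu r0)); near=> e.
apply: ge_ereal_sup => _ [x /= xr <-]; apply: ge_ereal_sup => _ [y Sxy <-].
rewrite lee_fin; apply: SK Sxy; rewrite (le_trans xr)// lerD2l.
by near: e; exact: nbhs_right_le.
Unshelve. all: by end_near. Qed.

Lemma mu_nd r s : 0 <= r -> r <= s -> mu r <= mu s.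
Proof.
move=> r0; rewrite le_eqVlt => /predU1P[->//|rs].
apply: (@mu_le _ (s - r)) => //; first by rewrite subr_gt0.
by move=> x y; rewrite subrKC => xs Sxy; apply: (mu_ub _ xs Sxy); rewrite (le_trans r0)// ltW.
Qed.

(** Bounding S on the ball of radius r + eta bounds mu (r + eta / 2). *)
Lemma mu_right_continuous (r e : R) : 0 <= r -> 0 < e ->
  exists2 eta, 0 < eta & mu (r + eta) <= mu r + e.
Proof.
move=> r0 e0.
pose U eta := ereal_sup [set setnorm (S x) | x in [set x : R | `|x| <= r + eta]].
have : \forall eta \near (0 : R)^'+, (U eta < (mu r + e)%:E)%E.
  have hU : nbhs (mu r)%:E [set x | (x < (mu r + e)%:E)%E].
    by apply: open_nbhs_nbhs; split; [exact: open_ereal_lt_ereal|rewrite /= lte_fin ltrDl].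
  exact: (hmu r0 hU).
move=> H; near (0 : R)^'+ => eta.
have eta0 : 0 < eta by near: eta; exact: nbhs_right_gt.
exists (eta / 2); first by rewrite divr_gt0.
apply: (@mu_le _ (eta / 2)).
- by rewrite addr_ge0// divr_ge0// ltW.
- by rewrite divr_gt0.
move=> x y; rewrite -addrA -splitr => xr Sxy; rewrite -lee_fin; apply: ltW.
apply: (@le_lt_trans _ _ (U eta)).
  apply: (@le_trans _ _ (setnorm (S x))).
    by apply: ereal_sup_ubound; exists y.
  by apply: ereal_sup_ubound; exists x.
by near: eta.
Unshelve. all: by end_near. Qed.

Hypothesis S00 : S 0 0.
Hypothesis mu_lt : forall r : R, 0 < r -> mu r < r.

Lemma mu_ge0 r : 0 <= r -> 0 <= mu r.
Proof. by move=> r0; apply: le_trans (mu_ub r0 _ S00); rewrite normr0. Qed.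

Lemma mu_le_id r : 0 <= r -> mu r <= r.
Proof.
rewrite le_eqVlt => /predU1P[<-|/mu_lt/ltW//].
rewrite leNgt; apply/negP => m0.
have := mu_lt m0; rewrite ltNge => /negP; apply.
by apply: mu_nd => //; exact: ltW.
Qed.

(** To the right of r, by right-continuity; to the left of r, since mu s <= mu r
    stays below s as long as s is close to r. *)
Lemma mu_gap_local r : 0 < r -> exists zeta c, [/\ 0 < zeta, 0 < c &
  forall s, r - zeta <= s -> s <= r + zeta -> c <= s - mu s].
Proof.
move=> r0; pose d := (r - mu r) / 2.
have mr := mu_lt r0; have m0 := mu_ge0 (ltW r0).
have d0 : 0 < d by rewrite /d; lra.
have [eta eta0 meta] := mu_right_continuous (ltW r0) d0.
exists (Num.min eta (d / 2)), (d / 2); split.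
- by rewrite lt_min eta0/= divr_gt0.
- by rewrite divr_gt0.
have hd : d * 2 = r - mu r by rewrite /d divfK.
clearbody d; move=> s; case: (leP eta (d / 2)) => ed s1 s2.
  have : mu s <= mu (r + eta) by apply: mu_nd; lra.
  by move: meta hd ed s1 s2 m0; lra.
have : mu s <= mu (r + eta) by apply: mu_nd; lra.
by move: meta hd ed s1 s2 m0; lra.
Qed.

Lemma mu_gap e M : 0 < e -> e <= M -> exists2 c, 0 < c &
  forall r, e <= r -> r <= M -> c <= r - mu r.
Proof.
move=> e0 eM.
(* The infimum of the r for which the gap is uniform on [r, M] is e, since the
   local gap would extend any larger one to the left. *)
pose T := [set r | e <= r /\ exists2 c, 0 < c & forall s, r <= s -> s <= M -> c <= s - mu s].
have TM : T M.
  split => //; exists (M - mu M); first by rewrite subr_gt0 mu_lt// (lt_le_trans e0).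
  by move=> s Ms sM; have -> : s = M by apply/eqP; rewrite eq_le sM.
have infT : has_inf T by split; [exists M|exists e => x []].
have eT : e <= inf T by apply: lb_le_inf; [exists M|move=> x []].
have [zeta [c [zeta0 c0 hc]]] := mu_gap_local (lt_le_trans e0 eT).
have [r [er [c' c'0 hc']] rz] := inf_adherent zeta0 infT.
have Te : T (Num.max e (inf T - zeta)).
  split; first by rewrite le_max lexx.
  exists (Num.min c c'); first by rewrite lt_min c0.
  move=> s; rewrite ge_max => /andP[es sz] sM; rewrite ge_min.
  have [sr|rs] := leP s r; last by rewrite hc' ?orbT// ltW.
  by rewrite hc// (le_trans sr)// ltW.
have := ge_inf infT.2 Te; rewrite le_max => /orP[Te'|]; last by lra.
have {}Te' : inf T = e by apply/eqP; rewrite eq_le Te'.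
move: Te; rewrite Te' max_l ?gerBl ?ltW// => -[_ [c1 c10 hc1]].
by exists c1.
Qed.

Section recursion.
Variables (y delta : nat -> R).
Hypotheses (y0 : forall n, 0 <= y n) (delta0 : forall n, 0 <= delta n).
Hypothesis yS : forall n, y n.+1 <= mu (y n + delta n) + delta n.

Let yd0 n : 0 <= y n + delta n. Proof. exact: addr_ge0. Qed.

Lemma recursion_le n : y n <= y 0%N + 2 * series delta n.
Proof.
elim: n => [|n ih]; first by rewrite /series/= big_geq// mulr0 addr0.
rewrite (le_trans (yS n))//.
have := mu_le_id (yd0 n); rewrite seriesSr; have := ih; lra.
Qed.

(** W n = y n + delta n plus the tail of the disturbances still to come is
    nonincreasing, and W n.+1 <= mu (W n) + o(1).  A positive limit l of W would
    satisfy l <= mu l by right-continuity. *)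
Lemma recursion_cvg0 : cvgn (series delta) -> y n @[n --> \oo] --> 0.
Proof.
move=> cd; set L := limn (series delta).
(* T n is the sum of delta k + delta k.+1 over k >= n. *)
pose T n := (L - series delta n) + (L - series delta n.+1).
pose W n := y n + delta n + T n.
have Lge n : series delta n <= L.
  apply: nondecreasing_cvgn_le => //; apply/nondecreasing_seqP => k.
  by rewrite seriesSr lerDl.
have T0 n : 0 <= T n by rewrite addr_ge0// subr_ge0.
have Tcvg : T n @[n --> \oo] --> 0.
  have -> : 0 = (L - L) + (L - L) :> R by rewrite subrr addr0.
  apply: cvgD.
    by apply: cvgB => //; exact: cvg_cst.
  apply: cvgB; first exact: cvg_cst.
  by rewrite (cvg_shiftS (series delta)).
have WS n : W n.+1 <= mu (W n) + T n.
  have h : mu (y n + delta n) <= mu (W n) by apply: mu_nd => //; rewrite lerDl.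
  have := yS n; rewrite /W /T !seriesSr; rewrite /W /T !seriesSr in h; lra.
have WS' n : W n.+1 <= W n.
  have h := mu_le_id (yd0 n).
  have := yS n; rewrite /W /T !seriesSr; lra.
have W0 n : 0 <= W n by rewrite addr_ge0.
have cW : cvgn W.
  apply: nonincreasing_is_cvgn; first exact/nonincreasing_seqP.
  by exists 0 => _ [n _ <-].
have Wge n : limn W <= W n.
  by apply: nonincreasing_cvgn_ge => //; exact/nonincreasing_seqP.
have l0 : 0 <= limn W by apply: limr_ge => //; exact: nearW.
have lW : limn W = 0.
  apply/eqP; rewrite eq_le l0 andbT leNgt; apply/negP => lpos.
  pose e := (limn W - mu (limn W)) / 2.
  have e0 : 0 < e by rewrite /e; have := mu_lt lpos; lra.
  have [eta eta0 meta] := mu_right_continuous l0 e0.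
  have near1 : \forall n \near \oo, W n < limn W + eta.
    by apply: (cvgr_lt _ cW); rewrite ltrDl.
  have near2 : \forall n \near \oo, T n < e by exact: (cvgr_lt _ Tcvg).
  near \oo => n.
  have h1 : W n < limn W + eta by near: n.
  have h2 : T n < e by near: n.
  have := mu_nd (W0 n) (ltW h1).
  have := WS n; have := Wge n.+1; rewrite /e in h2 meta *; lra.
apply: (@squeeze_cvgr _ _ _ _ (fun=> 0) W).
- by near=> n; rewrite y0/= /W -addrA lerDl addr_ge0.
- exact: cvg_cst.
- by rewrite -lW.
Unshelve. all: by end_near. Qed.

(** As long as y n + eta >= eps, a step loses c and gains at most 2 eta <= c / 2;
    afterwards y n + eta never exceeds eps + 2 eta. *)
Lemma recursion_gap eps c eta n : 0 <= c -> 4 * eta <= c ->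
  (forall k, delta k <= eta) -> (forall r, eps <= r -> c <= r - mu r) ->
  y n + eta <= Num.max (eps + 2 * eta) (y 0%N + eta - n%:R * (c / 2)).
Proof.
move=> c0 etac de gap.
have eta0 : 0 <= eta := le_trans (delta0 0%N) (de 0%N).
elim: n => [|n ih]; first by rewrite le_max mul0r subr0 lexx orbT.
have w0 : 0 <= y n + eta by rewrite addr_ge0.
have h : y n.+1 + eta <= mu (y n + eta) + 2 * eta.
  have : mu (y n + delta n) <= mu (y n + eta) by apply: mu_nd => //; rewrite lerD2l.
  have := yS n; have := de n; lra.
rewrite le_max; have [we|ew] := leP eps (y n + eta).
  have gw := gap _ we.
  move: ih; rewrite le_max => /orP[ih|ih].
    by apply/orP; left; lra.
  apply/orP; right; rewrite -natr1; lra.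
by apply/orP; left; have := mu_le_id w0; lra.
Qed.

(** The excess over the threshold eps contracts: eps is absorbed since
    lam * w - eps <= lam * (w - eps).  A bound of the form
    lam * y n + eps + 2 * delta n would instead sum up to eps / (1 - lam), which
    need not be small, as lam depends on eps. *)
Lemma recursion_contraction eps lam n : 0 <= eps -> 0 <= lam -> lam <= 1 ->
  (forall r, eps <= r -> mu r <= lam * r) ->
  Num.max (y n.+1 - eps) 0 <= lam * Num.max (y n - eps) 0 + 2 * delta n.
Proof.
move=> eps0 l0 l1 hl; set h := Num.max (y n - eps) 0.
have hy : y n - eps <= h by rewrite le_max lexx.
have h0 : 0 <= h by rewrite le_max lexx orbT.
have d0 := delta0 n; have yn := yS n.
rewrite ge_max; apply/andP; split; last by rewrite addr_ge0 ?mulr_ge0.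
have ld : lam * delta n <= delta n by rewrite ler_piMl.
have le : lam * eps <= eps by rewrite ler_piMl.
have lh : lam * (y n - eps) <= lam * h by rewrite ler_wpM2l.
have [we|ew] := leP eps (y n + delta n).
  by have := hl _ we; rewrite mulrDr; rewrite mulrBr in lh; lra.
have := mu_nd (yd0 n) (ltW ew); have := hl _ (lexx eps).
have : 0 <= lam * h by rewrite mulr_ge0.
lra.
Qed.

End recursion.
End gain.

(** * Trajectories period by period *)

(** The values at the times s, s + 2, s + 4 and so on, with s in ]-1, 1[, form a
    trajectory of the scalar recursion; the disturbance enters between them. *)
Definition period {R : realType} (G : R -> R) (n : nat) (s : R) := G (s + 2 * n%:R).

Definition period_input {R : realType} (delta : R -> R) (n : nat) (s : R) :=
  delta (s + (2 * n%:R + 1)).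

Section periods.
Context {R : realType}.
Local Notation leb := (@lebesgue_measure R).
Implicit Types (p : \bar R).

Lemma ae_periods (P : R -> Prop) : {ae leb, forall t, 0 <= t -> P t} ->
  {ae leb, forall s, -1 < s -> forall n : nat, P (s + (2 * n%:R + 1))}.
Proof.
move=> hP.
have : {ae leb, forall s, forall n : nat, -1 < s -> P (s + (2 * n%:R + 1))}.
  apply: ae_foralln => n.
  apply: (aeS _ (leb_preserving_ae (leb_preserving_addr (2 * n%:R + 1)) hP)).
  by move=> s hs s1; apply: hs; have : 0 <= n%:R :> R by []; lra.
by apply: aeS => s hs s1 n; exact: hs.
Qed.

Variables (mu : R -> R) (S : R -> set R) (Sigma : set (R * R)).
Hypothesis hmu : gain S mu.
Hypothesis hS : [set xy : R * R | S xy.1 xy.2] = rotation @` Sigma.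
Hypothesis mu_lt : forall r : R, 0 < r -> mu r < r.

Variables (p : \bar R) (G delta : R -> R).
Hypothesis p1 : (1 <= p)%E.
Hypotheses (mG : measurable_fun setT G) (mdelta : measurable_fun setT delta).
Hypotheses (G0 : forall x, 0 <= G x) (delta0 : forall x, 0 <= delta x).
Hypothesis GL : forall T : R, (Lpnorm p `](-1)%R, T[ (EFin \o G) < +oo)%E.
Hypothesis relation : delay_relation Sigma G delta.

Local Notation y := (period G).
Local Notation dl := (period_input delta).

Lemma period_ge0 n s : 0 <= y n s. Proof. exact: G0. Qed.

Lemma period_input_ge0 n s : 0 <= dl n s. Proof. exact: delta0. Qed.

Lemma measurable_period n : measurable_fun setT (y n).
Proof. by apply: (measurableT_comp mG); exact: measurable_funD. Qed.

Lemma measurable_period_input n : measurable_fun setT (dl n).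
Proof. by apply: (measurableT_comp mdelta); exact: measurable_funD. Qed.

Lemma Lpnorm_period n : Lpnorm p `]-1, 1[ (EFin \o y n) =
  Lpnorm p `]2 * n%:R - 1, 2 * n%:R + 1[ (EFin \o G).
Proof. exact: Lpnorm_shift. Qed.

Lemma Lpnorm_period_fin n : (Lpnorm p `](-1)%R, 1%R[ (EFin \o y n) < +oo)%E.
Proof.
rewrite Lpnorm_period; apply: le_lt_trans (GL (2 * n%:R + 1)); apply: Lpnorm_ae_le => //.
apply: aeW => x; rewrite /= !in_itv/= => /andP[x1 x2]; split => //.
by rewrite x2 andbT; have : 0 <= n%:R :> R by []; lra.
Qed.

Lemma Lpnorm_period_input_le n : (Lpnorm p `](-1)%R, 1%R[ (EFin \o dl n) <=
  Lpnorm p `[0%R, +oo[ (EFin \o delta))%E.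
Proof.
rewrite Lpnorm_shift//; apply: Lpnorm_ae_le => //.
apply: aeW => x; rewrite /= !in_itv/= => /andP[x1 x2]; split => //.
by rewrite andbT; have : 0 <= n%:R :> R by []; lra.
Qed.

Lemma period_recursion : {ae leb, forall s, -1 < s -> forall n,
  y n.+1 s <= mu (y n s + dl n s) + dl n s}.
Proof.
apply: (aeS _ (ae_periods relation)) => s hs s1 n.
have [a [b [Sab ha hb]]] := hs s1 n.
have Sab' : S a b by have : [set xy : R * R | S xy.1 xy.2] (a, b) by rewrite hS.
rewrite /period /period_input.
have -> : s + 2 * n.+1%:R = s + (2 * n%:R + 1) + 1 by rewrite -[n.+1%:R]natr1; ring.
have E : s + 2 * n%:R = s + (2 * n%:R + 1) - 1 by ring.
rewrite -E in ha; apply: (le_trans hb); rewrite lerD2r.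
by apply: (mu_ub hmu _ ha Sab'); rewrite addr_ge0.
Qed.

(** The geometric sum of [recursion_contraction] in L^p: the excess over eps has
    norm at most lam ^ n A + 2 D / (1 - lam), and the constant eps at most
    2 eps. *)
Lemma contraction_estimate eps lam A D n : 0 <= eps -> 0 <= lam -> lam < 1 ->
  (forall r, eps <= r -> mu r <= lam * r) ->
  (Lpnorm p `](-1)%R, 1%R[ (EFin \o y 0%N) <= A%:E)%E ->
  (Lpnorm p `[0%R, +oo[ (EFin \o delta) <= D%:E)%E ->
  (Lpnorm p `](-1)%R, 1%R[ (EFin \o y n) <=
    (2 * eps + lam ^+ n * A + 2 * D / (1 - lam))%:E)%E.
Proof.
move=> e0 l0 l1 hl hA hD.
pose h n s := Num.max (y n s - eps) 0.
have h0 k s : 0 <= h k s by rewrite le_max lexx orbT.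
have mh k : measurable_fun setT (h k).
  apply: measurable_maxr => //; apply: measurable_funB => //; exact: measurable_period.
have D0 : 0 <= D by rewrite -lee_fin; apply: le_trans hD; exact: Lnorm_ge0.
have key k : (Lpnorm p `](-1)%R, 1%R[ (EFin \o h k) <=
    (lam ^+ k * A + 2 * D / (1 - lam))%:E)%E.
  elim: k => [|k ih].
    apply: (@le_trans _ _ A%:E); last first.
      by rewrite expr0 mul1r lee_fin lerDl divr_ge0 ?mulr_ge0// subr_ge0 ltW.
    apply: le_trans hA; apply: Lpnorm_ae_le => //; apply: aeW => x xI; split => //=.
    rewrite lee_fin (ger0_norm (h0 _ _)) (ger0_norm (period_ge0 _ _)) ge_max period_ge0 andbT.
    by rewrite gerBl.
  apply: (@le_trans _ _ (Lpnorm p `](-1)%R, 1%R[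
      (EFin \o ((fun s => lam * h k s) \+ (fun s => 2 * dl k s))%R))).
    apply: Lpnorm_ae_le => //; apply: (aeS _ period_recursion) => s hs.
    rewrite /= in_itv/= => /andP[s1 s2]; split; first by rewrite s1.
    rewrite lee_fin (ger0_norm (h0 _ _)) ger0_norm; last first.
      by rewrite addr_ge0// mulr_ge0// period_input_ge0.
    exact: (recursion_contraction hmu (period_ge0^~ s) (period_input_ge0^~ s) (hs s1) k e0 l0 (ltW l1) hl).
  apply: le_trans (Lpnorm_add _ _ _ _) _ => //.
  - by apply: measurable_funM.
  - by apply: measurable_funM => //; exact: measurable_period_input.
  rewrite !Lpnorm_scale//; last exact: measurable_period_input.
  apply: (@le_trans _ _ (lam%:E * (lam ^+ k * A + 2 * D / (1 - lam))%:E + 2%:E * D%:E)%E).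
    by apply: leeD; apply: lee_pmul; rewrite ?lee_fin// ?Lnorm_ge0//
      (le_trans (Lpnorm_period_input_le k)).
  rewrite -!EFinM -EFinD lee_fin exprS le_eqVlt; apply/orP; left; apply/eqP.
  by field; rewrite subr_eq0 gt_eqF.
apply: (@le_trans _ _ (Lpnorm p `](-1)%R, 1%R[ (EFin \o ((fun=> eps) \+ h n)%R))).
  apply: Lpnorm_ae_le => //; apply: aeW => s sI; split => //=.
  rewrite lee_fin (ger0_norm (period_ge0 _ _)) ger0_norm ?addr_ge0//.
  by rewrite -lerBlDl le_max lexx.
apply: le_trans (Lpnorm_add _ _ _ _) _ => //.
by rewrite -addrA EFinD; apply: leeD => //; exact: Lpnorm_cst.
Qed.

(** The pointwise bound of [recursion_gap] is uniform in s because y 0 and the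
    disturbance are essentially bounded. *)
Lemma uniform_estimate eps c A D n : p = +oo%E -> 0 < eps -> 0 <= c -> 4 * D <= c ->
  (forall r, eps <= r -> c <= r - mu r) ->
  (Lpnorm p `](-1)%R, 1%R[ (EFin \o y 0%N) <= A%:E)%E ->
  (Lpnorm p `[0%R, +oo[ (EFin \o delta) <= D%:E)%E ->
  (Lpnorm p `](-1)%R, 1%R[ (EFin \o y n) <=
    (Num.max (eps + D) (A - n%:R * (c / 2)))%:E)%E.
Proof.
move=> py eps0 c0 Dc gap; rewrite py => hA hD.
have D0 : 0 <= D by rewrite -lee_fin; apply: le_trans hD; exact: Lnorm_ge0.
apply: ae_le_Lpnormy; first exact: period_ge0.
  by rewrite le_max addr_ge0// ltW.
have hA' := Lpnormy_ae_le (period_ge0 0%N) hA.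
have hD' : {ae leb, forall t, 0 <= t -> delta t <= D}.
  by apply: (aeS _ (Lpnormy_ae_le delta0 hD)) => t ht t0; apply: ht; rewrite /= in_itv/= t0.
apply: (aeS _ (ae_and hA' (ae_and (ae_periods hD') period_recursion))) => s [hAs [hDs rs]].
rewrite /= in_itv/= => /andP[s1 s2].
have := recursion_gap hmu mu_lt (period_ge0^~ s) (period_input_ge0^~ s) (rs s1) n c0 Dc (hDs s1) gap.
have := hAs _; rewrite /= in_itv/= s1 s2 => /(_ isT).
rewrite !le_max => hA0 /orP[h|h]; apply/orP; [left|right]; lra.
Qed.

End periods.

Section solution_periods.
Context {R : realType}.
Local Notation leb := (@lebesgue_measure R).
Implicit Types (p : \bar R).

Lemma solution_periods p (Sigma : set (R * R)) d z0 z1 z f g :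
  (1 <= p)%E -> lebesgue_measurable_fun `[0, +oo[ d ->
  solution p Sigma d z0 z1 z f g ->
  exists G delta : R -> R,
  [/\ [/\ measurable_fun setT G, measurable_fun setT delta,
          forall x, 0 <= G x & forall x, 0 <= delta x],
      forall T : R, (Lpnorm p `](-1)%R, T[ (EFin \o G) < +oo)%E,
      {ae leb, forall t, 0 <= t -> delta t = enorm (d t)},
      forall n : nat, energy p z f g (2 * n%:R) =
        Lpnorm p `](-1)%R, 1%R[ (EFin \o period G n) &
      delay_relation Sigma G delta].
Proof.
move=> p1 md sol.
have [G [delta [[mG mdel G0 del0] GL hdel EG rel]]] := solution_profile p1 md sol.
exists G, delta; split => // n.
by rewrite Lpnorm_period// EG// mulr_ge0.
Qed.

Lemma solution_bounds p (Sigma : set (R * R)) d z0 z1 z f g :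
  (1 <= p)%E -> Lp2 p d -> solution p Sigma d z0 z1 z f g ->
  exists G delta : R -> R,
  [/\ [/\ measurable_fun setT G, measurable_fun setT delta,
          forall x, 0 <= G x & forall x, 0 <= delta x],
      forall n : nat, energy p z f g (2 * n%:R) =
        Lpnorm p `](-1)%R, 1%R[ (EFin \o period G n),
      (Lpnorm p `](-1)%R, 1%R[ (EFin \o period G 0) <=
        (fine (energy p z f g 0%R))%:E)%E,
      (Lpnorm p `[0%R, +oo[ (EFin \o delta) <=
        (fine (Lpnorm2 p `[0%R, +oo[ d))%:E)%E &
      delay_relation Sigma G delta].
Proof.
move=> p1 [md dfin] sol.
have [G [delta [[mG mdel G0 del0] GL hdel En rel]]] := solution_periods p1 md sol.
exists G, delta; split => //.
  have E0 : energy p z f g 0 = Lpnorm p `](-1)%R, 1%R[ (EFin \o period G 0).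
    by rewrite -(En 0%N) mulr0.
  by rewrite E0 fineK// ge0_fin_numE ?Lnorm_ge0//; exact: Lpnorm_period_fin.
have <- : Lpnorm2 p `[0%R, +oo[ d = Lpnorm p `[0%R, +oo[ (EFin \o delta).
  apply: Lpnorm_ae_eq => //; apply: (aeS _ hdel) => t ht.
  by rewrite /= in_itv/= andbT => /ht ->.
by rewrite fineK// ge0_fin_numE ?Lnorm_ge0.
Qed.

(** The interval ]t - 1, t + 1[ meets at most two consecutive periods. *)
Lemma energy_two_periods (p : \bar R) (Sigma : set (R * R)) d z0 z1 z f g t :
  (1 <= p)%E -> lebesgue_measurable_fun `[0, +oo[ d ->
  solution p Sigma d z0 z1 z f g -> 0 <= t ->
  (energy p z f g t <= energy p z f g (2 * (Num.truncn (t / 2))%:R)%R +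
    energy p z f g (2 * (Num.truncn (t / 2)).+1%:R)%R)%E.
Proof.
move=> p1 md sol t0.
have [G [delta [[mG _ _ _] _ _ EG _]]] := solution_profile p1 md sol.
have t20 : 0 <= t / 2 by rewrite divr_ge0.
have /andP[h1 h2] := Num.Theory.truncn_itv t20.
set n := Num.truncn _ in h1 h2 *.
rewrite !EG ?mulr_ge0//.
have -> : 2 * n.+1%:R = 2 * n%:R + 2 :> R by rewrite -[n.+1%:R]natr1 mulrDr mulr1.
by apply: Lpnorm_two_intervals => //; rewrite -[n.+1%:R]natr1 in h2; lra.
Qed.

End solution_periods.

(** * Convergence of the energy to zero *)

Section decay.
Context {R : realType}.
Local Notation leb := (@lebesgue_measure R).
Implicit Types (p : \bar R).

Lemma energy_cvg0 p (Sigma : set (R * R)) d z0 z1 z f g :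
  (1 <= p)%E -> lebesgue_measurable_fun `[0, +oo[ d ->
  solution p Sigma d z0 z1 z f g ->
  (forall e, 0 < e -> \forall n \near \oo, (energy p z f g (2 * n%:R)%R <= e%:E)%E) ->
  energy p z f g t @[t --> +oo%R] --> 0%E.
Proof.
move=> p1 md sol he.
have small e : 0 < e -> \forall t \near +oo%R, (energy p z f g t <= e%:E)%E.
  move=> e0; have [N _ hN] := he _ (divr_gt0 e0 (ltr0n R 2)).
  near=> t.
  have t0 : 0 <= t by near: t; apply: nbhs_pinfty_ge; exact: num_real.
  have tN : 2 * N%:R <= t by near: t; apply: nbhs_pinfty_ge; exact: num_real.
  have Nt : (N <= Num.truncn (t / 2))%N.
    rewrite -(@Num.Theory.natrK R N); apply: Num.Theory.le_truncn.
    by rewrite ler_pdivlMr// mulrC.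
  apply: le_trans (energy_two_periods p1 md sol t0) _.
  rewrite [e]splitr EFinD; apply: leeD; apply: hN => //=.
  exact: leqW.
apply/fine_cvgP; split.
  apply: filterS (small _ ltr01) => t ht.
  by rewrite ge0_fin_numE ?energy_ge0// (le_lt_trans ht)// ltry.
apply/cvgrPdist_le => e e0; apply: filterS (small _ e0) => t ht.
rewrite sub0r normrN /= ger0_norm ?fine_ge0 ?energy_ge0//.
have fin : energy p z f g t \is a fin_num.
  by rewrite ge0_fin_numE ?energy_ge0// (le_lt_trans ht)// ltry.
by rewrite -lee_fin fineK.
Unshelve. all: by end_near. Qed.

Variables (mu : R -> R) (S : R -> set R) (Sigma : set (R * R)).
Hypothesis hmu : gain S mu.
Hypothesis hS : [set xy : R * R | S xy.1 xy.2] = rotation @` Sigma.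
Hypothesis mu_lt : forall r : R, 0 < r -> mu r < r.

Variables (p : \bar R) (G delta : R -> R).
Hypothesis p1 : (1 <= p)%E.
Hypotheses (mG : measurable_fun setT G) (mdelta : measurable_fun setT delta).
Hypotheses (G0 : forall x, 0 <= G x) (delta0 : forall x, 0 <= delta x).
Hypothesis GL : forall T : R, (Lpnorm p `](-1)%R, T[ (EFin \o G) < +oo)%E.
Hypothesis relation : delay_relation Sigma G delta.

Local Notation y := (period G).
Local Notation dl := (period_input delta).

(** The part of the bound of [recursion_gap] that depends on the initial value:
    for a finite exponent it tends to zero by dominated convergence, and for the
    essential supremum it vanishes after finitely many periods. *)
Lemma excess_vanishes N (eps c : R) : 0 < eps -> 0 < c -> \forall k \near \oo,
  (Lpnorm p `](-1)%R, 1%R[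
    (EFin \o (fun s => Num.max (y N s + eps - k%:R * (c / 2)) 0)%R) <= eps%:E)%E.
Proof.
move=> eps0 c0; have c20 : 0 < c / 2 by rewrite divr_gt0.
have big (a : R) (k : nat) : (Num.truncn (a / (c / 2)) < k)%N -> Num.max (a - k%:R * (c / 2)) 0 = 0.
  move=> hk; rewrite max_r// subr_le0 -ler_pdivrMr//; apply: ltW.
  by apply: lt_le_trans (Num.Theory.truncnS_gt _) _; rewrite ler_nat.
pose u k s := Num.max (y N s + eps - k%:R * (c / 2)) 0.
have u0 k s : 0 <= u k s by rewrite le_max lexx orbT.
have fin := Lpnorm_period_fin p1 mG GL N.
have mu_ k : measurable_fun setT (u k).
  apply: measurable_maxr => //; apply: measurable_funB => //; apply: measurable_funD => //.
  exact: measurable_period.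
have mM : measurable_fun setT (fun s => y N s + eps).
  by apply: measurable_funD => //; exact: measurable_period.
have y0 s : 0 <= y N s := period_ge0 G0 N s.
have MD : (Lpnorm p `](-1)%R, 1%R[ (EFin \o (fun s => (y N s + eps)%R)) < +oo)%E.
  apply: le_lt_trans (Lpnorm_add p1 _ (measurable_period mG N) (measurable_cst eps)) _ => //.
  rewrite lte_add_pinfty//; apply: le_lt_trans (Lpnorm_cst p1 (ltW eps0)) (ltry _).
case: p p1 fin MD => [r| |//].
  rewrite lee_fin => r1 _ MD; apply: (Lpnorm_dominated (u := u) r1 _ _ mu_ mM) => //.
  - apply: aeW => s _ k; rewrite ger0_norm// ge_max addr_ge0 ?(ltW eps0)// andbT.
    by rewrite gerBl mulr_ge0// ltW.
  - apply: aeW => s _; apply: cvg_near_cst.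
    by exists (Num.truncn ((y N s + eps) / (c / 2))).+1 => // k /= hk; exact: big.
move=> _ fin _; set A := fine (Lpnorm +oo%E `](-1)%R, 1%R[ (EFin \o y N)).
have hA : (Lpnorm +oo%E `](-1)%R, 1%R[ (EFin \o y N) <= A%:E)%E.
  by rewrite fineK// ge0_fin_numE ?Lnorm_ge0.
exists (Num.truncn ((A + eps) / (c / 2))).+1 => // k /= hk.
apply: ae_le_Lpnormy; [by move=> s; exact: u0|exact: ltW|].
apply: (aeS _ (Lpnormy_ae_le y0 hA)) => s hs sI; have {}hs := hs sI.
have := big _ _ hk; have : A + eps - k%:R * (c / 2) <= Num.max (A + eps - k%:R * (c / 2)) 0.
  by rewrite le_max lexx.
by rewrite ge_max (ltW eps0) andbT; lra.
Qed.

Lemma uniform_decay :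
  (forall eps, 0 < eps -> exists2 c, 0 < c & forall r, eps <= r -> c <= r - mu r) ->
  (forall eta, 0 < eta -> exists N : nat, {ae leb, forall s, -1 < s ->
    forall n, (N <= n)%N -> dl n s <= eta}) ->
  forall e, 0 < e -> \forall n \near \oo,
    (Lpnorm p `](-1)%R, 1%R[ (EFin \o y n) <= e%:E)%E.
Proof.
move=> hgap hdel e e0.
(* 7 = 2 * 3 + 1: the constant 3 eps has norm at most 6 eps, the excess eps. *)
pose eps := e / 7; have eps0 : 0 < eps by rewrite divr_gt0.
have eE : e = 2 * (3 * eps) + eps by rewrite /eps; field.
clearbody eps.
have [c c0 gap] := hgap _ eps0.
pose eta := Num.min eps (c / 4).
have eta0 : 0 < eta by rewrite lt_min eps0 divr_gt0.
have eta_eps : eta <= eps by rewrite ge_min lexx.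
have etac : 4 * eta <= c.
  have : eta <= c / 4 by rewrite ge_min lexx orbT.
  by lra.
have [N hN] := hdel _ eta0.
have [K _ hK] := excess_vanishes N eps0 c0.
exists (K + N)%N => // n /= Kn.
have [k -> kK] : exists2 k, n = (k + N)%N & (K <= k)%N.
  by exists (n - N)%N; [rewrite subnK// (leq_trans _ Kn)// leq_addl|rewrite leq_subRL 1?addnC// (leq_trans _ Kn)// leq_addl].
pose u s := Num.max (y N s + eps - k%:R * (c / 2)) 0.
apply: (@le_trans _ _ (Lpnorm p `](-1)%R, 1%R[ (EFin \o ((fun=> 3 * eps) \+ u)%R))).
  apply: Lpnorm_ae_le => //.
  apply: (aeS _ (ae_and hN (period_recursion hmu hS G0 delta0 relation))) => s [hs rs] sI; split => //.
  have s1 : -1 < s by move: sI; rewrite /= in_itv/= => /andP[].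
  have u0 : 0 <= u s by rewrite le_max lexx orbT.
  rewrite /= lee_fin !ger0_norm ?period_ge0 ?addr_ge0 ?mulr_ge0 ?(ltW eps0)//.
  have rsN j : y (j.+1 + N) s <= mu (y (j + N) s + dl (j + N) s) + dl (j + N) s := rs s1 _.
  have := recursion_gap hmu mu_lt (fun j => period_ge0 G0 (j + N) s) (fun j => period_input_ge0 delta0 (j + N) s)
    rsN k (ltW c0) etac (fun j => hs s1 _ (leq_addl j N)) gap.
  have u1 : y N s + eps - k%:R * (c / 2) <= u s by rewrite le_max lexx.
  by rewrite le_max add0n => /orP[] h; lra.
apply: le_trans (Lpnorm_add _ _ _ _) _ => //.
  apply: measurable_maxr => //; apply: measurable_funB => //; apply: measurable_funD => //.
  exact: measurable_period.
rewrite eE EFinD; apply: leeD; last exact: hK.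
by apply: Lpnorm_cst => //; rewrite mulr_ge0// ltW.
Qed.

Lemma summable_decay r : p = r%:E ->
  (Lpnorm p `](-1)%R, 1%R[ (fun s => \sum_(0 <= n <oo) (dl n s)%:E) < +oo)%E ->
  forall e, 0 < e -> \forall n \near \oo,
    (Lpnorm p `](-1)%R, 1%R[ (EFin \o y n) <= e%:E)%E.
Proof.
move=> pr; pose E (s : R) : \bar R := (\sum_(0 <= n <oo) (dl n s)%:E)%E.
rewrite -/E => EL e e0.
have r1 : 1 <= r by move: p1; rewrite pr lee_fin.
have r0 : 0 < r by exact: lt_le_trans r1.
pose D := `](-1)%R, 1%R[%classic : set R.
have mD : measurable D by exact: measurable_itv.
have mE : measurable_fun setT E.
  apply: ge0_emeasurable_sum => [k x _ _|k _]; first by rewrite lee_fin period_input_ge0.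
  by apply/measurable_EFinP; exact: measurable_period_input.
have E0 s : (0 <= E s)%E by apply: nneseries_ge0 => n _ _; rewrite lee_fin period_input_ge0.
have Efin : {ae leb, forall s, D s -> E s \is a fin_num}.
  have ifin : (\int[leb]_x (`|(E \_ D) x| `^ r) < +oo)%E.
    by move: EL; rewrite pr /Lpnorm unlock => /lty_poweRy; apply; rewrite invr_eq0 gt_eqF.
  have mED : measurable_fun setT (fun x => (`|(E \_ D) x| `^ r)%E).
    apply: (measurableT_comp (measurable_poweR _)); apply: measurableT_comp => //.
    by apply: (measurable_restrictT E mD).1; exact: measurable_funTS.
  have int : leb.-integrable setT (fun x => (`|(E \_ D) x| `^ r)%E).
    apply/integrableP; split => //; apply: le_lt_trans ifin.
    by under eq_integral do rewrite gee0_abs ?poweR_ge0//.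
  apply: (aeS _ (integrable_ae measurableT int)) => s /(_ I) hs Ds.
  rewrite ge0_fin_numE//; move: hs; rewrite patchE mem_set// ge0_fin_numE ?poweR_ge0//.
  by rewrite gee0_abs// => /lty_poweRy; apply; rewrite gt_eqF.
pose F s := fine (E s).
have mF : measurable_fun setT F by exact: measurableT_comp.
have F0 s : 0 <= F s by rewrite fine_ge0.
have FL : (Lpnorm p D (EFin \o F) < +oo)%E.
  apply: le_lt_trans EL; apply: Lpnorm_ae_le => //.
  apply: (aeS _ Efin) => s hs Ds; split => //.
  by have -> : (EFin \o F) s = E s by rewrite /F /= fineK// hs.
have mFF : measurable_fun setT (F \+ F)%R by exact: measurable_funD.
have my0 := measurable_period mG 0.
have ML : (Lpnorm p D (EFin \o (y 0%N \+ (F \+ F))%R) < +oo)%E.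
  apply: le_lt_trans (Lpnorm_add p1 mD my0 mFF) _.
  rewrite lte_add_pinfty ?Lpnorm_period_fin//.
  by apply: le_lt_trans (Lpnorm_add p1 mD mF mF) _; rewrite lte_add_pinfty.
have ser s : E s \is a fin_num -> forall n, series (dl^~ s) n <= F s.
  move=> Es n; rewrite -lee_fin fineK// -sumEFin.
  by apply: nneseries_lim_ge => k _ _; rewrite lee_fin period_input_ge0.
have rec := period_recursion hmu hS G0 delta0 relation.
rewrite pr in ML *.
apply: (Lpnorm_dominated r1 e0 mD (measurable_period mG) _ _ _ ML).
- exact: measurable_funD.
- apply: (aeS _ (ae_and Efin rec)) => s [Es rs] Ds n.
  have s1 : -1 < s by move: Ds; rewrite /D /= in_itv/= => /andP[].
  rewrite ger0_norm ?period_ge0//.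
  have := recursion_le hmu mu_lt (period_ge0 G0 ^~ s) (period_input_ge0 delta0 ^~ s) (rs s1) n.
  by have := ser _ (Es Ds) n; rewrite /=; lra.
- apply: (aeS _ (ae_and Efin rec)) => s [Es rs] Ds.
  have s1 : -1 < s by move: Ds; rewrite /D /= in_itv/= => /andP[].
  apply: (recursion_cvg0 hmu mu_lt (period_ge0 G0 ^~ s) (period_input_ge0 delta0 ^~ s) (rs s1)).
  apply: nondecreasing_is_cvgn.
    by apply/nondecreasing_seqP => k; rewrite seriesSr lerDl period_input_ge0.
  by exists (F s) => _ [n _ <-]; exact: ser (Es Ds) n.
Qed.

End decay.

Section hypotheses.
Context {R : realType}.

Lemma enorm_le (v : R * R) : enorm v <= `|v.1| + `|v.2|.
Proof.
have h : 0 <= `|v.1| + `|v.2| by rewrite addr_ge0.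
rewrite /enorm -[leRHS]ger0_norm// -sqrtr_sqr ler_wsqrtr// sqrrD !real_normK ?num_real//.
by rewrite lerD2r lerDl mulrn_wge0// mulr_ge0.
Qed.

Lemma enorm_vanishes (d : R -> R * R) eta :
  d t @[t --> +oo%R] --> ((0, 0) : R * R) -> 0 < eta ->
  exists N : nat, forall t, 2 * N%:R <= t -> enorm (d t) <= eta.
Proof.
move=> hd eta0; have e0 : 0 < eta / 2 by rewrite divr_gt0.
have : \forall t \near +oo%R, ball ((0, 0) : R * R) (eta / 2) (d t).
  have nb : nbhs ((0, 0) : R * R) (ball ((0, 0) : R * R) (eta / 2)) by exact: nbhsx_ballx.
  exact: hd nb.
move=> [M [_ hM]]; exists (Num.truncn `|M|).+1 => t tM.
have Mt : M < t.
  have := Num.Theory.truncnS_gt `|M|; have := ler_norm M; have := normr_ge0 M; lra.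
have [] := hM t Mt; rewrite /ball/= !sub0r !normrN => h1 h2.
by apply: le_trans (enorm_le _) _; lra.
Qed.

Lemma uniform_gap (mu : R -> R) (eps : R) :
  (0 < ereal_inf [set (r - mu r)%:E | r in [set r : R | (eps <= r)%R]])%E ->
  exists2 c, 0 < c & forall r, eps <= r -> c <= r - mu r.
Proof.
set X := (X in ereal_inf X) => X0.
have lb r : eps <= r -> (ereal_inf X <= (r - mu r)%:E)%E.
  by move=> er; apply: ereal_inf_lbound; exists r.
have fin : ereal_inf X \is a fin_num.
  by rewrite ge0_fin_numE ?(ltW X0)// (le_lt_trans (lb _ (lexx _)))// ltry.
exists (fine (ereal_inf X)) => [|r er]; first by rewrite fine_gt0// X0 -ge0_fin_numE// ltW.
by rewrite -lee_fin fineK//; exact: lb.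
Qed.

End hypotheses.

(** * Majorants of classes KL and K *)

(** A function B a s with the monotonicity and the limits of class KL, but
    possibly discontinuous and not strictly monotone, is regularized by the
    sup-convolution with the penalty 2 k (a - A)^+ + (t - s)^+.  The slope 2 k
    beats the growth B a s <= k a, so the supremum is finite and is governed by
    a <= 2 A; and a supremum of functions with a common Lipschitz constant is
    Lipschitz. *)
Section class_KL.
Context {R : realType}.
Variables (k : R) (B : R -> R -> R).
Hypotheses (k0 : 0 < k)
  (B0 : forall a s, 0 <= a -> 0 <= s -> 0 <= B a s)
  (Bk : forall a s, 0 <= a -> 0 <= s -> B a s <= k * a)
  (Bnd : forall a a' s, 0 <= a -> a <= a' -> 0 <= s -> B a s <= B a' s)
  (Bni : forall a s s', 0 <= a -> 0 <= s -> s <= s' -> B a s' <= B a s)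
  (Blim : forall a e, 0 <= a -> 0 < e -> exists2 s, 0 <= s & B a s <= e).

Definition sup_convolution_set (A t : R) :=
  [set B x.1 x.2 - 2 * k * Num.max (x.1 - A) 0 - Num.max (t - x.2) 0 |
    x in [set x : R * R | 0 <= x.1 /\ 0 <= x.2]].

Definition sup_convolution (A t : R) := sup (sup_convolution_set A t).

Let H := sup_convolution.

Lemma sup_convolution_le A t K :
  (forall a s, 0 <= a -> 0 <= s ->
    B a s - 2 * k * Num.max (a - A) 0 - Num.max (t - s) 0 <= K) -> H A t <= K.
Proof.
move=> hK; apply: ge_sup.
  by exists (B 0 0 - 2 * k * Num.max (0 - A) 0 - Num.max (t - 0) 0); exists (0, 0).
by move=> _ [[a s] /= [a0 s0] <-]; exact: hK.
Qed.

Lemma sup_convolution_term a A s t : 0 <= a -> 0 <= s ->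
  B a s - 2 * k * Num.max (a - A) 0 - Num.max (t - s) 0 <= k * Num.max A 0.
Proof.
move=> a0 s0; have h := Bk a0 s0.
have m1 : 0 <= Num.max (t - s) 0 by rewrite le_max lexx orbT.
have m2 : k * a - 2 * k * Num.max (a - A) 0 <= k * Num.max A 0.
  rewrite -[2 * k]mulrC -mulrA -mulrBr ler_pM2l//.
  by case: (leP (a - A) 0); case: (leP A 0); lra.
lra.
Qed.

Lemma sup_convolution_ge a A s t : 0 <= a -> 0 <= s ->
  B a s - 2 * k * Num.max (a - A) 0 - Num.max (t - s) 0 <= H A t.
Proof.
move=> a0 s0; apply: ub_le_sup; last by exists (a, s).
exists (k * Num.max A 0) => _ [[a' s'] /= [a'0 s'0] <-].
exact: sup_convolution_term.
Qed.

Lemma sup_convolution_ub A t : H A t <= k * Num.max A 0.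
Proof. by apply: sup_convolution_le => a s *; exact: sup_convolution_term. Qed.

Lemma le_sup_convolution A t : 0 <= A -> 0 <= t -> B A t <= H A t.
Proof.
move=> A0 t0; have := @sup_convolution_ge A A t t A0 t0.
by rewrite !subrr maxxx mulr0 !subr0.
Qed.

Lemma sup_convolution_nd A A' t : A <= A' -> H A t <= H A' t.
Proof.
move=> AA'; apply: sup_convolution_le => a s a0 s0.
apply: le_trans (sup_convolution_ge A' t a0 s0); rewrite lerD2r lerD2l lerN2.
rewrite ler_pM2l ?mulr_gt0// ge_max !le_max lexx orbT andbT.
by apply/orP; left; lra.
Qed.

Lemma sup_convolution_ni A t t' : t <= t' -> H A t' <= H A t.
Proof.
move=> tt'; apply: sup_convolution_le => a s a0 s0.
apply: le_trans (sup_convolution_ge A t a0 s0); rewrite lerD2l lerN2.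
rewrite ge_max !le_max lexx orbT andbT.
by apply/orP; left; lra.
Qed.

Lemma sup_convolution_lipschitz A A' t t' :
  H A t - H A' t' <= 2 * k * `|A - A'| + `|t - t'|.
Proof.
rewrite lerBlDr; apply: sup_convolution_le => a s a0 s0.
have := sup_convolution_ge A' t' a0 s0.
have h1 : 2 * k * Num.max (a - A') 0 <= 2 * k * Num.max (a - A) 0 + 2 * k * `|A - A'|.
  rewrite -mulrDr ler_pM2l ?mulr_gt0//.
  have := ler_norm (A - A'); have := normr_ge0 (A - A').
  by case: (leP (a - A) 0); case: (leP (a - A') 0); lra.
have h2 : Num.max (t' - s) 0 <= Num.max (t - s) 0 + `|t - t'|.
  have := ler_norm (- (t - t')); rewrite normrN; have := normr_ge0 (t - t').
  by case: (leP (t - s) 0); case: (leP (t' - s) 0); lra.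
lra.
Qed.

Lemma sup_convolution_cvg0 A : 0 <= A -> H A t @[t --> +oo%R] --> 0.
Proof.
move=> A0; apply/cvgrPdist_le => e e0.
(* Beyond a = 2 A the penalty exceeds B a s <= k a; up to a = 2 A, either s is
   past the time t0 at which B (2 A) is small or t - s is large. *)
have A20 : 0 <= 2 * A by rewrite mulr_ge0.
have [t0 t00 Be] := Blim A20 e0.
near=> t.
have tt : t0 + 2 * k * A <= t by near: t; apply: nbhs_pinfty_ge; exact: num_real.
have t0' : 0 <= t by near: t; apply: nbhs_pinfty_ge; exact: num_real.
rewrite sub0r normrN ger0_norm; last first.
  exact: le_trans (B0 A0 t0') (le_sup_convolution A0 t0').
apply: sup_convolution_le => a s a0 s0.
have h := Bk a0 s0.
have m1 : 0 <= Num.max (t - s) 0 by rewrite le_max lexx orbT.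
have m2 : 0 <= 2 * k * Num.max (a - A) 0 by rewrite !mulr_ge0 ?le_max ?lexx ?orbT// ltW.
have [aA|Aa] := leP a (2 * A); last first.
  have h3 : k * a <= 2 * k * Num.max (a - A) 0.
    rewrite -[2 * k]mulrC -mulrA ler_pM2l//.
    by case: (leP (a - A) 0); lra.
  lra.
have [ts|st] := leP t0 s.
  have := Bnd a0 aA s0; have := Bni A20 t00 ts; lra.
have h4 : t - s <= Num.max (t - s) 0 by rewrite le_max lexx.
have h5 : k * a <= k * (2 * A) by rewrite ler_pM2l.
lra.
Unshelve. all: by end_near. Qed.

(** The term A exp (- t) makes the monotonicity strict in both variables. *)
Lemma classKL_majorant : exists2 beta, classKL beta &
  forall A t, 0 <= A -> 0 <= t -> B A t <= beta A t.
Proof.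
pose beta (A t : R) := H A t + A * expR (- t).
have cH : continuous (fun xt : R * R => H xt.1 xt.2).
  move=> x; apply/cvgrPdist_lt => e e0.
  have k1 : 0 < 2 * k + 1 by rewrite addr_gt0// mulr_gt0.
  have e1 : 0 < e / (2 * k + 1) by rewrite divr_gt0.
  have nb : nbhs x (ball x (e / (2 * k + 1))) by exact: nbhsx_ballx.
  near=> y.
  have [y1 y2] : ball x (e / (2 * k + 1)) y by near: y.
  move: y1 y2; rewrite /ball/= => y1 y2.
  have h1 := sup_convolution_lipschitz x.1 y.1 x.2 y.2.
  have h2 := sup_convolution_lipschitz y.1 x.1 y.2 x.2.
  rewrite [`|y.1 - _|]distrC [`|y.2 - _|]distrC in h2.
  have : `|H x.1 x.2 - H y.1 y.2| <= 2 * k * `|x.1 - y.1| + `|x.2 - y.2|.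
    by rewrite ler_norml; apply/andP; split; lra.
  move=> /le_lt_trans; apply.
  have -> : e = 2 * k * (e / (2 * k + 1)) + e / (2 * k + 1) by field; rewrite gt_eqF.
  by rewrite ltrD// ltr_pM2l// mulr_gt0.
have cbeta : continuous (fun xt : R * R => beta xt.1 xt.2).
  move=> x; apply: cvgD; first exact: cH.
  apply: cvgM; first exact: cvg_fst.
  apply: continuous_comp; last exact: continuous_expR.
  by apply: cvgN; exact: cvg_snd.
have expR_gt0 (t : R) : 0 < expR (- t) by exact: expR_gt0.
exists beta; last first.
  move=> A t A0 t0; apply: le_trans (le_sup_convolution A0 t0) _.
  by rewrite lerDl mulr_ge0// ltW.
split.
- exact: continuous_subspaceT.
- move=> t t0; split.
  + apply: continuous_subspaceT => A.
    apply: (@continuous_comp _ _ _ (fun A : R => (A, t)) (fun xt : R * R => beta xt.1 xt.2)).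
      by apply: (@cvg_pair _ _ _ _ (nbhs A) (nbhs t) _ _ _ (fun x => x) (fun=> t)); [exact: cvg_id|exact: cvg_cst].
    exact: cbeta.
  + move=> x y _ _ xy; apply: ler_ltD; first exact/sup_convolution_nd/ltW.
    by rewrite ltr_pM2r.
  + rewrite /beta mul0r addr0; apply/eqP; rewrite eq_le; apply/andP; split.
      by apply: le_trans (sup_convolution_ub _ _) _; rewrite maxxx mulr0.
    exact: le_trans (B0 (lexx 0) t0) (le_sup_convolution (lexx 0) t0).
- move=> x x0; split.
  + move=> s t _ _ st; apply: ler_ltD; first exact/sup_convolution_ni/ltW.
    by rewrite ltr_pM2l// ltr_expR ltrN2.
  + rewrite -[X in _ --> X]addr0; apply: cvgD.
      by apply: sup_convolution_cvg0; exact: ltW.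
    rewrite -[X in _ --> X](mulr0 x); apply: cvgM; first exact: cvg_cst.
    exact: cvgr_expR.
Unshelve. all: by end_near. Qed.

End class_KL.

(** Here G may grow arbitrarily fast, so a penalty of fixed slope does not give a
    finite supremum.  The factor min (1, 2 D / x - 1) is 1 for x <= D and
    nonpositive for x >= 2 D, so that the values of G beyond 2 D are not seen. *)
Section class_K.
Context {R : realType}.
Variable G : R -> R.
Hypotheses (G0 : forall x, 0 <= x -> 0 <= G x)
  (Gnd : forall x y, 0 <= x -> x <= y -> G x <= G y)
  (Glim : forall e, 0 < e -> exists2 x, 0 < x & G x <= e).

(** The element 0 makes the supremum vanish for D <= 0. *)
Definition ramp_set (D : R) : set R :=
  [set 0] `|` [set G x * Num.min 1 (2 * D / x - 1) | x in [set x | 0 < x]].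

Let K D := sup (ramp_set D).

Lemma ramp_nonpos D x : 0 < x -> 2 * D <= x -> G x * Num.min 1 (2 * D / x - 1) <= 0.
Proof.
move=> x0 Dx; rewrite mulr_ge0_le0 ?G0 ?(ltW x0)// ge_min.
by rewrite lerBlDr add0r ler_pdivrMr// mul1r Dx orbT.
Qed.

Lemma ramp_le D x : 0 < x -> G x * Num.min 1 (2 * D / x - 1) <= G (2 * `|D|).
Proof.
move=> x0; have D0 : 0 <= 2 * `|D| by rewrite mulr_ge0.
have [Dx|xD] := leP (2 * D) x; first by rewrite (le_trans (ramp_nonpos x0 Dx)) ?G0.
apply: (@le_trans _ _ (G x)).
  by rewrite ler_piMr ?G0 ?(ltW x0)// ge_min lexx.
by apply: Gnd; [exact: ltW|have := ler_norm D; lra].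
Qed.

Lemma ramp_sup_le D M : 0 <= M ->
  (forall x, 0 < x -> G x * Num.min 1 (2 * D / x - 1) <= M) -> K D <= M.
Proof.
move=> M0 hM; apply: ge_sup; first by exists 0; left.
by move=> _ [->//|[x x0 <-]]; exact: hM.
Qed.

Lemma ramp_ub D : has_ubound (ramp_set D).
Proof.
exists (G (2 * `|D|)) => _ [->|[x x0 <-]]; last exact: ramp_le.
by rewrite G0// mulr_ge0.
Qed.

Lemma ramp_sup_ge D x : 0 < x -> G x * Num.min 1 (2 * D / x - 1) <= K D.
Proof. by move=> x0; apply: ub_le_sup (ramp_ub D) _ _; right; exists x. Qed.

Lemma ramp_sup_ge0 D : 0 <= K D.
Proof. by apply: ub_le_sup (ramp_ub D) _ _; left. Qed.

Lemma ramp_sup_nd D D' : D <= D' -> K D <= K D'.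
Proof.
move=> DD'; apply: ramp_sup_le; first exact: ramp_sup_ge0.
move=> x x0; apply: le_trans (ramp_sup_ge D' x0).
rewrite ler_wpM2l ?G0 ?(ltW x0)// le_min ge_min lexx/= ge_min.
by apply/orP; right; rewrite lerD2r ler_pM2r ?invr_gt0// ler_pM2l.
Qed.

(** Only x in ]m, 2 M] matters: for x <= m the factor is 1 at both points, and for
    x > 2 M it is nonpositive at both. *)
Lemma ramp_sup_lipschitz m M D D' : 0 < m -> m <= D -> D <= M -> m <= D' -> D' <= M ->
  K D <= K D' + G (2 * M) * (2 / m) * `|D - D'|.
Proof.
move=> m0 mD DM mD' D'M.
have M0 : 0 <= 2 * M by lra.
have L0 : 0 <= G (2 * M) * (2 / m) * `|D - D'|.
  by rewrite !mulr_ge0 ?G0// invr_ge0 ltW.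
have KD' := ramp_sup_ge0 D'.
apply: ramp_sup_le; first by rewrite addr_ge0.
move=> x x0; have [xm|mx] := leP x m.
  apply: (@le_trans _ _ (K D')); last by rewrite lerDl.
  apply: le_trans (ramp_sup_ge D' x0).
  rewrite ler_wpM2l ?G0 ?(ltW x0)// [leRHS]min_l ?ge_min ?lexx//.
  by rewrite lerBrDr ler_pdivlMr//; lra.
have [xM|Mx] := leP x (2 * M); last first.
  by apply: (@le_trans _ _ 0); [apply: ramp_nonpos => //; lra|rewrite addr_ge0].
have := ramp_sup_ge D' x0.
have : G x * Num.min 1 (2 * D / x - 1) <=
    G x * Num.min 1 (2 * D' / x - 1) + G (2 * M) * (2 / m) * `|D - D'|.
  have GxM : G x * (2 / m * `|D - D'|) <= G (2 * M) * (2 / m) * `|D - D'|.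
    rewrite -[leRHS]mulrA ler_wpM2r ?Gnd ?(ltW x0)//.
    by rewrite mulr_ge0// divr_ge0// ltW.
  apply: le_trans (lerD (lexx _) GxM); rewrite -mulrDr ler_wpM2l ?G0 ?(ltW x0)//.
  have d1 : 2 * D / x - 2 * D' / x <= 2 / m * `|D - D'|.
    rewrite -mulrBl -mulrBr -[leLHS]mulrA -[leRHS]mulrA ler_pM2l// mulrC.
    apply: (@le_trans _ _ (x^-1 * `|D - D'|)).
      by rewrite ler_pM2l ?invr_gt0// ler_norm.
    by rewrite ler_wpM2r// lef_pV2// ?posrE// ltW.
  have d0 : 0 <= 2 / m * `|D - D'| by rewrite mulr_ge0// divr_ge0// ltW.
  case: (leP 1 (2 * D / x - 1)); case: (leP 1 (2 * D' / x - 1)); move: d1 d0; lra.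
lra.
Qed.

Lemma classK_majorant : exists2 gamma, classK gamma &
  forall D, 0 <= D -> G D <= gamma D.
Proof.
have K0 : K 0 = 0.
  apply/eqP; rewrite eq_le ramp_sup_ge0 andbT; apply: ramp_sup_le => // x x0.
  by apply: ramp_nonpos => //; rewrite mulr0 ltW.
exists (fun D => K D + D); last first.
  move=> D; rewrite le_eqVlt => /predU1P[<-|D0].
    rewrite K0 addr0 leNgt; apply/negP => G00.
    have [x x0 Gx] := Glim (divr_gt0 G00 (ltr0n R 2)).
    have := Gnd (lexx 0) (ltW x0); lra.
  have := ramp_sup_ge D D0.
  by rewrite mulfK ?gt_eqF// min_l ?mulr1; lra.
split; last by rewrite K0 addr0.
- apply/continuous_within_itvcyP; split.
    move=> D; rewrite in_itv/= andbT => D0; apply: cvgD; last exact: cvg_id.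
    apply/cvgrPdist_lt => e e0.
    (* The Lipschitz constant on the neighbourhood [D / 2, 2 D] of D. *)
    pose L := G (2 * (2 * D)) * (2 / (D / 2)).
    have L0 : 0 <= L by rewrite mulr_ge0 ?G0 ?divr_ge0 ?mulr_ge0 ?ltW.
    have e1 : 0 < e / (L + 1) by rewrite divr_gt0// ltr_wpDl.
    near=> D'.
    have h1 : D / 2 <= D' by apply: ltW; near: D'; apply: lt_nbhsr; rewrite gtr_pMr// invf_lt1// ltr1n.
    have h2 : D' <= 2 * D by apply: ltW; near: D'; apply: lt_nbhsl; rewrite ltr_pMl// ltr1n.
    have h3 : `|D - D'| < e / (L + 1).
      near: D'; have := @cvgr_dist_lt _ _ _ (nbhs D) _ id D (@cvg_id _ _) _ e1; exact.
    have m0 : 0 < D / 2 by rewrite divr_gt0.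
    have k1 := @ramp_sup_lipschitz _ (2 * D) D D' m0 _ _ h1 h2.
    have k2 := @ramp_sup_lipschitz _ (2 * D) D' D m0 h1 h2 _ _.
    rewrite distrC in k2.
    have : `|K D - K D'| <= L * `|D - D'|.
      by rewrite ler_norml; apply/andP; split; rewrite /L; [move: k2|move: k1]; lra.
    move=> /le_lt_trans; apply.
    apply: (@le_lt_trans _ _ (L * (e / (L + 1)))).
      by rewrite ler_wpM2l// ltW.
    by rewrite mulrA ltr_pdivrMr ?ltr_wpDl// mulrC ltr_pM2l// ltrDl.
  rewrite K0; apply: cvgD; last exact: cvg_at_right_filter.
  apply/cvgrPdist_le => e e0; have [x x0 Gx] := Glim e0.
  near=> D.
  have D0 : 0 <= D by near: D; exact: nbhs_right_ge.
  have Dx : D <= x / 2 by near: D; apply: nbhs_right_le; rewrite divr_gt0.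
  rewrite sub0r normrN ger0_norm ?ramp_sup_ge0//.
  apply: ramp_sup_le; first exact: ltW.
  move=> y y0; apply: le_trans (ramp_le D y0) _; apply: le_trans Gx.
  by apply: Gnd; rewrite ger0_norm//; lra.
- by move=> D D' _ _ DD'; apply: ler_ltD => //; exact/ramp_sup_nd/ltW.
Unshelve. all: by end_near. Qed.

End class_K.

(** * Input-to-state stability *)

(** The energy is bounded by b theta A n + g theta' D for all parameters theta in
    V and theta' in W D, so also by the sum of the two infima.  These have the
    properties required by the two regularizations above; the factor 2 accounts
    for the two periods met by ]t - 1, t + 1[. *)
Section criterion.
Context {R : realType}.
Variables (p : \bar R) (Sigma : set (R * R)) (T : Type).
Variables (V : set T) (b : T -> R -> nat -> R).
Variables (W : R -> set T) (g : T -> R -> R).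
Hypothesis p1 : (1 <= p)%E.
Hypothesis b_ge0 : forall theta A n, V theta -> 0 <= A -> 0 <= b theta A n.
Hypothesis b_nd : forall theta A A' n, V theta -> 0 <= A -> A <= A' ->
  b theta A n <= b theta A' n.
Hypothesis b_ni : forall theta A n m, V theta -> 0 <= A -> (n <= m)%N ->
  b theta A m <= b theta A n.
Hypothesis b_small : forall e, 0 < e -> exists theta, [/\ V theta,
  forall A, 0 <= A -> b theta A 0 <= e + A &
  forall A, 0 <= A -> exists n, b theta A n <= e].
Hypothesis W_anti : forall D D', 0 <= D -> D <= D' -> W D' `<=` W D.
Hypothesis W_nonempty : forall D, 0 <= D -> W D !=set0.
Hypothesis g_ge0 : forall theta D, 0 <= D -> W D theta -> 0 <= g theta D.
Hypothesis g_nd : forall theta D D', 0 <= D -> D <= D' -> W D' theta ->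
  g theta D <= g theta D'.
Hypothesis g_small : forall e, 0 < e ->
  exists D theta, [/\ 0 < D, W D theta & g theta D <= e].
Hypothesis estimate : forall d z0 z1 z f f',
  Lp2 p d -> solution p Sigma d z0 z1 z f f' ->
  forall n theta theta', V theta -> W (fine (Lpnorm2 p `[0%R, +oo[ d)) theta' ->
  (energy p z f f' (2 * n%:R)%R <=
    (b theta (fine (energy p z f f' 0%R)) n +
     g theta' (fine (Lpnorm2 p `[0%R, +oo[ d)))%:E)%E.

Let Bset A n := [set b theta A n | theta in V].
Let Gset D := [set g theta D | theta in W D].

Let Bset0 A n : Bset A n !=set0.
Proof. by have [theta [Vt _ _]] := b_small ltr01; exists (b theta A n); exists theta. Qed.

Let Bset_lb A n : 0 <= A -> lbound (Bset A n) 0.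
Proof. by move=> A0 _ [theta Vt <-]; exact: b_ge0. Qed.

Let Gset0 D : 0 <= D -> Gset D !=set0.
Proof. by move=> D0; have [theta Wt] := W_nonempty D0; exists (g theta D); exists theta. Qed.

Let Gset_lb D : 0 <= D -> lbound (Gset D) 0.
Proof. by move=> D0 _ [theta Wt <-]; exact: g_ge0. Qed.

Let Binf A n := inf (Bset A n).
Let Ginf D := inf (Gset D).

Let Binf_le theta A n : 0 <= A -> V theta -> Binf A n <= b theta A n.
Proof.
by move=> A0 Vt; apply: ge_inf; [exists 0; exact: Bset_lb|exists theta].
Qed.

Let Ginf_le theta D : 0 <= D -> W D theta -> Ginf D <= g theta D.
Proof.
by move=> D0 Vt; apply: ge_inf; [exists 0; exact: Gset_lb|exists theta].
Qed.

Lemma ISS_of_estimate : ISS p Sigma.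
Proof.
pose n_ (t : R) := Num.truncn (t / 2).
pose B A t := 2 * Binf A (n_ t).
have B0 A t : 0 <= A -> 0 <= t -> 0 <= B A t.
  by move=> A0 _; rewrite mulr_ge0//; apply: lb_le_inf; [exact: Bset0|exact: Bset_lb].
have BA A t : 0 <= A -> 0 <= t -> B A t <= 2 * A.
  move=> A0 _; rewrite ler_pM2l//; apply/ler_addgt0Pl => e e0.
  have [theta [Vt h _]] := b_small e0.
  by rewrite (le_trans (Binf_le _ A0 Vt))// (le_trans _ (h _ A0))// b_ni.
have Bnd A A' t : 0 <= A -> A <= A' -> 0 <= t -> B A t <= B A' t.
  move=> A0 AA' _; rewrite ler_pM2l//; apply: lb_le_inf; first exact: Bset0.
  move=> _ [theta Vt <-]; apply: le_trans (Binf_le _ A0 Vt) _; exact: b_nd.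
have Bni A s t : 0 <= A -> 0 <= s -> s <= t -> B A t <= B A s.
  move=> A0 s0 st; rewrite ler_pM2l//; apply: lb_le_inf; first exact: Bset0.
  move=> _ [theta Vt <-]; apply: le_trans (Binf_le _ A0 Vt) _; apply: b_ni => //.
  by apply: Num.Theory.le_truncn; rewrite ler_pM2r ?invr_gt0.
have Blim A e : 0 <= A -> 0 < e -> exists2 s, 0 <= s & B A s <= e.
  move=> A0 e0; have [theta [Vt _ /(_ _ A0)[n hn]]] := b_small (divr_gt0 e0 (ltr0n R 2)).
  exists (2 * n%:R); first by rewrite mulr_ge0.
  have nn : n_ (2 * n%:R) = n.
    by rewrite /n_ mulrAC mulfV// mul1r Num.Theory.natrK.
  have := Binf_le n A0 Vt; rewrite /B nn; lra.
have [beta Kbeta hbeta] := classKL_majorant (ltr0n R 2) B0 BA Bnd Bni Blim.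
have G0 D : 0 <= D -> 0 <= 2 * Ginf D.
  by move=> D0; rewrite mulr_ge0//; apply: lb_le_inf; [exact: Gset0|exact: Gset_lb].
have Gnd D D' : 0 <= D -> D <= D' -> 2 * Ginf D <= 2 * Ginf D'.
  move=> D0 DD'; have D'0 := le_trans D0 DD'.
  rewrite ler_pM2l//; apply: lb_le_inf; first exact: Gset0.
  move=> _ [theta Wt <-]; apply: le_trans (Ginf_le D0 (W_anti D0 DD' Wt)) _.
  exact: g_nd.
have Glim e : 0 < e -> exists2 D, 0 < D & 2 * Ginf D <= e.
  move=> e0; have [D [theta [D0 Wt gt]]] := g_small (divr_gt0 e0 (ltr0n R 2)).
  by exists D => //; have := Ginf_le (ltW D0) Wt; lra.
have [gamma Kgamma hgamma] := classK_majorant G0 Gnd Glim.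
exists beta, gamma; split => // d z0 z1 z f f' _ dL sol t t0.
set A := fine (energy p z f f' 0%R); set D := fine (Lpnorm2 _ _ _).
have A0 : 0 <= A by rewrite fine_ge0// energy_ge0.
have D0 : 0 <= D by rewrite fine_ge0// Lnorm_ge0.
(* The two parameters are optimized independently. *)
have key n : (energy p z f f' (2 * n%:R)%R <= (Binf A n + Ginf D)%:E)%E.
  have est := estimate dL sol n; rewrite -/A -/D in est.
  have [th [Vth _ _]] := b_small ltr01; have [th' Wth'] := W_nonempty D0.
  have fin : energy p z f f' (2 * n%:R)%R \is a fin_num.
    rewrite ge0_fin_numE ?energy_ge0//.
    exact: le_lt_trans (est _ _ Vth Wth') (ltry _).
  rewrite -(fineK fin) lee_fin -lerBlDr.
  apply: lb_le_inf; first exact: Bset0.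
  move=> _ [theta Vt <-]; rewrite lerBlDr -lerBlDl.
  apply: lb_le_inf; first exact: Gset0.
  move=> _ [theta' Wt <-]; rewrite lerBlDl -lee_fin (fineK fin).
  exact: est.
apply: le_trans (energy_two_periods p1 dL.1 sol t0) _.
apply: le_trans (leeD (key _) (key _)) _.
rewrite -EFinD lee_fin.
have h1 := hbeta _ _ A0 t0; have h2 := hgamma _ D0.
have h3 : Binf A (n_ t).+1 <= Binf A (n_ t).
  apply: lb_le_inf; first exact: Bset0.
  move=> _ [theta Vt <-]; apply: le_trans (Binf_le _ A0 Vt) _; exact: b_ni.
move: h1 h2 h3; rewrite /B /n_; lra.
Qed.

End criterion.

Section stability.
Context {R : realType}.
Variables (S : R -> set R) (mu : R -> R) (Sigma : set (R * R)).
Hypothesis hmu : gain S mu.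
Hypothesis hS : [set xy : R * R | S xy.1 xy.2] = rotation @` Sigma.
Hypothesis S00 : S 0 0.
Hypothesis mu_lt : forall r : R, 0 < r -> mu r < r.

Lemma sector_rotation (M a b : R) : 0 < a -> 0 < b ->
  (forall x y, Sigma (x, y) -> 0 <= x * y) ->
  (forall x y : R, Sigma (x, y) -> ~ (enorm (x, y) < M) ->
            a * `|x| <= `|y| <= b * `|x|) ->
  exists lam, [/\ 0 <= lam, lam < 1 &
    forall X Y, S X Y -> `|X| <= M \/ `|Y| <= lam * `|X|].
Proof.
move=> a0 b0 dS hsec.
(* With m = |x| |y|, the sector gives x ^ 2 + y ^ 2 <= q m, whereas
   2 X ^ 2 = x ^ 2 + y ^ 2 + 2 m and 2 Y ^ 2 = x ^ 2 + y ^ 2 - 2 m;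
   hence Y ^ 2 <= kap X ^ 2. *)
pose q := a^-1 + b; have q0 : 0 < q by rewrite addr_gt0 ?invr_gt0.
pose kap := q / (q + 2).
have q20 : 0 < q + 2 by rewrite addr_gt0.
have kq : kap * (q + 2) = q by rewrite divfK ?gt_eqF.
have k1 : kap < 1 by rewrite ltr_pdivrMr// mul1r ltrDl.
have k0 : 0 <= kap by rewrite divr_ge0 ?ltW.
(* (1 + kap) / 2 bounds the square root of kap and stays below 1. *)
exists ((1 + kap) / 2); split; [lra|lra|].
move=> X Y SXY.
have [[x y] Sxy [EX EY]] : (rotation @` Sigma) (X, Y) by rewrite -hS.
have [h1 _] := rotation_le_enorm (x, y).
have [sM|Ms] := pselect (enorm (x, y) < M).
  left; rewrite -EX /=; apply: le_trans (ltW sM).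
  by rewrite normrM normfV [`|Num.sqrt 2|]ger0_norm ?sqrtr_ge0.
right; have /andP[ax xb] := hsec _ _ Sxy Ms.
have xy0 := dS _ _ Sxy.
pose m := `|x| * `|y|.
have m0 : 0 <= m by rewrite mulr_ge0.
have mxy : m = x * y by rewrite /m -normrM ger0_norm.
have w : x ^+ 2 + y ^+ 2 <= q * m.
  rewrite /q mulrDl; apply: lerD.
    rewrite ler_pdivlMl// -real_normK ?num_real// /m expr2 mulrA mulrAC mulrC.
    by rewrite ler_wpM2l.
  by rewrite -[y ^+ 2]real_normK ?num_real// /m expr2 mulrA ler_wpM2r.
clearbody m kap q.
have X2 : X ^+ 2 = (x ^+ 2 + y ^+ 2 + 2 * m) / 2.
  rewrite -EX/= exprMn exprVn sqr_sqrtr// mxy; congr (_ / 2); ring.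
have Y2 : Y ^+ 2 = (x ^+ 2 + y ^+ 2 - 2 * m) / 2.
  rewrite -EY/= exprMn exprVn sqr_sqrtr// mxy; congr (_ / 2); ring.
rewrite -(@ler_pXn2r _ 2)// ?nnegrE ?mulr_ge0 ?divr_ge0 ?addr_ge0//.
rewrite exprMn !real_normK ?num_real//.
apply: (@le_trans _ _ (kap * X ^+ 2)).
  rewrite X2 Y2 -(ler_pM2r q20).
  set v := x ^+ 2 + y ^+ 2 in w *.
  have -> : kap * ((v + 2 * m) / 2) * (q + 2) = kap * (q + 2) * ((v + 2 * m) / 2) by ring.
  have qm : 0 <= q * m by rewrite mulr_ge0 ?(ltW q0).
  by rewrite kq; nra.
rewrite ler_wpM2r ?sqr_ge0// -subr_ge0.
have -> : ((1 + kap) / 2) ^+ 2 - kap = ((1 - kap) / 2) ^+ 2 by field.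
exact: sqr_ge0.
Qed.

(** Beyond radius M the sector condition contracts, and within it mu is at most
    mu M < M; between eps and M the gap c of [mu_gap] gives
    mu r <= r - c <= (1 - c / M) r. *)
Lemma sector_contraction (M a b : R) : 0 < M -> 0 < a -> 0 < b ->
  (forall x y, Sigma (x, y) -> 0 <= x * y) ->
  (forall x y : R, Sigma (x, y) -> ~ (enorm (x, y) < M) ->
            a * `|x| <= `|y| <= b * `|x|) ->
  forall eps, 0 < eps -> exists lam, [/\ 0 <= lam, lam < 1 &
    forall r, eps <= r -> mu r <= lam * r].
Proof.
move=> M0 a0 b0 dS hsec.
have [lam [l0 l1 hl]] := sector_rotation a0 b0 dS hsec.
have muM : 0 <= mu M by apply: (mu_ge0 hmu S00); exact: ltW.
have far r : M <= r -> mu r <= Num.max lam (mu M / M) * r.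
  move=> Mr; have r0 : 0 <= r by rewrite (le_trans _ Mr)// ltW.
  have h : mu r <= Num.max (lam * r) (mu M).
    apply/ler_addgt0Pl => e e0; apply: (mu_le hmu r0 e0) => X Y Xr SXY.
    have [XM|YX] := hl _ _ SXY.
      by rewrite (le_trans (mu_ub hmu (ltW M0) XM SXY))// ler_wpDl ?(ltW e0)// le_max lexx orbT.
    apply: (le_trans YX); apply: (@le_trans _ _ (e + lam * r)); last first.
      by rewrite lerD2l le_max lexx.
    apply: (@le_trans _ _ (lam * (r + e))); first by rewrite ler_wpM2l.
    by rewrite mulrDr addrC lerD2r ler_piMl ?ltW.
  apply: (le_trans h); rewrite ge_max; apply/andP; split.
    by rewrite ler_wpM2r// le_max lexx.
  apply: (@le_trans _ _ (mu M / M * r)); last by rewrite ler_wpM2r// le_max lexx orbT.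
  by rewrite mulrAC ler_pdivlMr// ler_wpM2l.
have l'1 : Num.max lam (mu M / M) < 1.
  by rewrite gt_max l1 ltr_pdivrMr// mul1r mu_lt.
move=> eps eps0.
pose M' := Num.max eps M.
have M'0 : 0 < M' by rewrite lt_max M0 orbT.
have eM' : eps <= M' by rewrite le_max lexx.
have [c c0 hc] := mu_gap hmu S00 mu_lt eps0 eM'.
have cM' : c <= M' by have := hc _ eM' (lexx _); have := mu_ge0 hmu S00 (ltW M'0); lra.
exists (Num.max (Num.max lam (mu M / M)) (1 - c / M')); split.
- by rewrite !le_max l0.
- by rewrite gt_max l'1 ltrBlDr ltrDl divr_gt0.
move=> r er; have r0 : 0 <= r := le_trans (ltW eps0) er.
have [rM|Mr] := leP r M'; last first.
  apply: (@le_trans _ _ (Num.max lam (mu M / M) * r)).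
    by apply: far; apply: le_trans (ltW Mr); rewrite le_max lexx orbT.
  by rewrite ler_wpM2r// le_max lexx.
apply: (@le_trans _ _ ((1 - c / M') * r)); last by rewrite ler_wpM2r// le_max lexx orbT.
have h := hc _ er rM; rewrite mulrBl mul1r.
have : c / M' * r <= c by rewrite mulrAC ler_pdivrMr// ler_wpM2l// ltW.
lra.
Qed.

(** A pair (eps, lam) is a parameter if mu r <= lam r for r >= eps.  Two pairs
    merge into (max eps eps', min lam lam'). *)
Lemma ISS_sector p : (1 <= p)%E ->
  (forall eps, 0 < eps -> exists lam, [/\ 0 <= lam, lam < 1 &
    forall r, eps <= r -> mu r <= lam * r]) ->
  ISS p Sigma.
Proof.
move=> p1 hlam.
pose V := [set th : R * R | [/\ 0 < th.1, 0 <= th.2, th.2 < 1 &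
  forall r, th.1 <= r -> mu r <= th.2 * r]].
have exV eps : 0 < eps -> exists2 lam, lam < 1 & V (eps, lam).
  by move=> e0; have [lam [l0 l1 hl]] := hlam _ e0; exists lam.
apply: (@ISS_of_estimate _ p Sigma _ V (fun th A n => 2 * th.1 + th.2 ^+ n * A)
  (fun=> V) (fun th D => 2 * th.1 + 2 * D / (1 - th.2))) => //.
- move=> [eps lam] A n [/= e0 l0 l1 _] A0.
  by rewrite addr_ge0 ?mulr_ge0 ?exprn_ge0// ltW.
- move=> [eps lam] A A' n [/= e0 l0 l1 _] A0 AA'.
  by rewrite lerD2l ler_wpM2l// exprn_ge0.
- move=> [eps lam] A n m [/= e0 l0 l1 _] A0 nm.
  by rewrite lerD2l ler_wpM2r// ler_wiXn2l// ltW.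
- move=> e e0; have [lam l1 Vl] := exV (e / 4) (divr_gt0 e0 (ltr0n R 4)).
  exists (e / 4, lam); split => //= [A A0|A A0]; first by rewrite expr0 mul1r; lra.
  have [_ l0 _ _] := Vl; rewrite /= in l0.
  have cv : (lam ^+ n * A) @[n --> \oo] --> 0.
    rewrite -[X in _ --> X](mul0r A); apply: cvgM; last exact: cvg_cst.
    by apply: cvg_expr; rewrite ger0_norm.
  have e20 : 0 < e / 2 by rewrite divr_gt0.
  have : \forall n \near \oo, lam ^+ n * A < e / 2 by exact: (cvgr_lt _ cv).
  by move=> [n _ /(_ n (leqnn n)) hn]; exists n; lra.
- by move=> D D' _ _ th.
- by move=> D D0; have [lam _ Vl] := exV 1 ltr01; exists (1, lam).
- move=> [eps lam] D D0 [/= e0 l0 l1 _].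
  by rewrite addr_ge0 ?divr_ge0 ?mulr_ge0 ?subr_ge0// ltW.
- move=> [eps lam] D D' D0 DD' [/= e0 l0 l1 _].
  by rewrite lerD2l ler_pM2r ?invr_gt0 ?subr_gt0// ler_pM2l.
- move=> e e0; have [lam l1 Vl] := exV (e / 4) (divr_gt0 e0 (ltr0n R 4)).
  exists ((1 - lam) * (e / 4)), (e / 4, lam); split => //=.
    by rewrite mulr_gt0 ?subr_gt0// divr_gt0.
  rewrite [X in _ + X](_ : _ = e / 2); first by lra.
  by field; rewrite subr_eq0 gt_eqF.
move=> d z0 z1 z f g dL sol n [e1 l1] [e2 l2] [/= e10 l10 l11 h1] [/= e20 l20 l21 h2].
have [G [delta [[mG mdel G0 del0] En hA hD rel]]] := solution_bounds p1 dL sol.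
set A := fine (energy p z f g 0) in hA *; set D := fine _ in hD *.
have A0 : 0 <= A by rewrite fine_ge0// energy_ge0.
have D0 : 0 <= D by rewrite fine_ge0// Lnorm_ge0.
pose em := Num.max e1 e2; pose lm := Num.min l1 l2.
have em0 : 0 <= em by rewrite le_max (ltW e10).
have lm0 : 0 <= lm by rewrite le_min l10.
have lm1 : lm < 1 by rewrite gt_min l11.
have hm r : em <= r -> mu r <= lm * r.
  rewrite ge_max => /andP[er1 er2].
  rewrite /lm; case: (leP l1 l2) => _; [exact: h1|exact: h2].
rewrite En; apply: le_trans (contraction_estimate hmu hS p1 mG mdel G0 del0 rel n em0 lm0 lm1 hm hA hD) _.
rewrite lee_fin.
have k1 : em <= e1 + e2 by rewrite ge_max lerDl lerDr (ltW e10) (ltW e20).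
have k2 : lm ^+ n * A <= l1 ^+ n * A.
  by rewrite ler_wpM2r// lerXn2r ?nnegrE// ge_min lexx.
have k3 : 2 * D / (1 - lm) <= 2 * D / (1 - l2).
  rewrite ler_wpM2l ?mulr_ge0// lef_pV2 ?posrE ?subr_gt0// lerD2l lerN2.
  by rewrite ge_min lexx orbT.
by rewrite /=; lra.
Qed.

(** A pair (eps, c) is a parameter if r - mu r >= c for r >= eps.  Two pairs merge
    into (max eps eps', max c c'); the disturbance term requires 4 D <= c'. *)
Lemma ISS_uniform (p : \bar R) : p = +oo%E ->
  (r - mu r) @[r --> +oo%R] --> +oo%R -> ISS p Sigma.
Proof.
move=> py hinf.
have far c : exists2 r0, 0 < r0 & forall r, r0 <= r -> c <= r - mu r.
  have : \forall r \near +oo%R, c <= r - mu r by exact: (cvgryPge _).1 hinf c.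
  move=> [M [_ hM]]; exists (Num.max 1 (M + 1)); first by rewrite lt_max ltr01.
  by move=> r; rewrite ge_max => /andP[_ Mr]; apply: hM; lra.
have gap eps : 0 < eps -> exists2 c, 0 < c & forall r, eps <= r -> c <= r - mu r.
  move=> e0; have [r0 r00 hr0] := far 1.
  have eM : eps <= Num.max eps r0 by rewrite le_max lexx.
  have [c c0 hc] := mu_gap hmu S00 mu_lt e0 eM.
  exists (Num.min c 1); first by rewrite lt_min c0 ltr01.
  move=> r er; rewrite ge_min; have [rr|rr] := leP r0 r; first by rewrite hr0 ?orbT.
  by rewrite hc// le_max (ltW rr) orbT.
pose V := [set th : R * R | [/\ 0 < th.1, 0 < th.2 &
  forall r, th.1 <= r -> th.2 <= r - mu r]].
have p1 : (1 <= p)%E by rewrite py leey.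
apply: (@ISS_of_estimate _ p Sigma _ V
  (fun th A n => th.1 + Num.max (A - n%:R * (th.2 / 2)) 0)
  (fun D => [set th | V th /\ 4 * D <= th.2]) (fun th D => th.1 + D)) => //.
- move=> [eps c] A n [/= e0 c0 _] A0.
  by rewrite addr_ge0 ?(ltW e0)// le_max lexx orbT.
- move=> [eps c] A A' n [/= e0 c0 _] A0 AA'.
  rewrite lerD2l ge_max !le_max lexx orbT andbT.
  by apply/orP; left; lra.
- move=> [eps c] A n m [/= e0 c0 _] A0 nm.
  rewrite lerD2l ge_max !le_max lexx orbT andbT.
  by apply/orP; left; rewrite lerD2l lerN2 ler_wpM2r ?divr_ge0 ?(ltW c0)// ler_nat.
- move=> e e0; have [c c0 hc] := gap e e0.
  exists (e, c); split => //= [A A0|A A0].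
    by rewrite mul0r subr0 max_l.
  have c20 : 0 < c / 2 by rewrite divr_gt0.
  exists (Num.truncn (A / (c / 2))).+1; rewrite max_r ?addr0//.
  rewrite subr_le0 -ler_pdivrMr//; apply: ltW; exact: Num.Theory.truncnS_gt.
- by move=> D D' D0 DD' [eps c] [Vt /= hD']; split => //=; lra.
- move=> D D0; have [r0 r00 hr0] := far (4 * D + 1).
  by exists (r0, 4 * D + 1); split => /=; [split => //=; lra|lra].
- by move=> [eps c] D D0 [[/= e0 _ _] _]; rewrite addr_ge0// ltW.
- by move=> [eps c] D D' D0 DD' _ /=; rewrite lerD2l.
- move=> e e0; have e20 : 0 < e / 2 by rewrite divr_gt0.
  have [c c0 hc] := gap _ e20.
  exists (Num.min (c / 4) (e / 2)), (e / 2, c); split => /=.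
  + by rewrite lt_min e20 andbT divr_gt0.
  + split; first by split.
    have : Num.min (c / 4) (e / 2) <= c / 4 by rewrite ge_min lexx.
    by rewrite /=; lra.
  + have : Num.min (c / 4) (e / 2) <= e / 2 by rewrite ge_min lexx orbT.
    lra.
move=> d z0 z1 z f g dL sol n [e1 c1] [e2 c2] [/= e10 c10 h1] [[/= e20 c20 h2] /= c2D].
have [G [delta [[mG mdel G0 del0] En hA hD rel]]] := solution_bounds p1 dL sol.
set A := fine (energy p z f g 0) in hA *; set D := fine _ in hD c2D *.
have D0 : 0 <= D by rewrite fine_ge0// Lnorm_ge0.
pose em := Num.max e1 e2; pose cm := Num.max c1 c2.
have em0 : 0 < em by rewrite lt_max e10.
have cm0 : 0 <= cm by rewrite le_max (ltW c10).
have Dcm : 4 * D <= cm by rewrite le_max c2D orbT.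
have hm r : em <= r -> cm <= r - mu r.
  by rewrite !ge_max => /andP[er1 er2]; rewrite h1 ?h2.
have est := uniform_estimate hmu hS mu_lt G0 del0 rel n py em0 cm0 Dcm hm hA hD.
rewrite En; apply: le_trans est _.
rewrite lee_fin ge_max.
have k1 : em <= e1 + e2 by rewrite ge_max lerDl lerDr (ltW e10) (ltW e20).
have k2 : A - n%:R * (cm / 2) <= A - n%:R * (c1 / 2).
  by rewrite lerD2l lerN2 ler_wpM2l// ler_pM2r// le_max lexx.
have k3 : A - n%:R * (c1 / 2) <= Num.max (A - n%:R * (c1 / 2)) 0 by rewrite le_max lexx.
have k4 : 0 <= Num.max (A - n%:R * (c1 / 2)) 0 by rewrite le_max lexx orbT.
by apply/andP; split; rewrite /=; lra.
Qed.

End stability.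

Theorem theorem63 (R : realType) (p : \bar R) (Sigma : set (R * R))
    (S : R -> set R) (mu : R -> R)
    (hp : (1 <= p)%E)
    (hSigma : damping_set Sigma)
    (hS : [set xy : R * R | S xy.1 xy.2] = rotation @` Sigma)
    (hmu : forall r : R, 0 <= r ->
      ereal_sup [set setnorm (S x) | x in [set x : R | `|x| <= r + eta]]
        @[eta --> (0 : R)^'+] --> (mu r)%:E)
    (hmu_lt : forall r : R, 0 < r -> mu r < r) :
  (forall (d : R -> R * R) (z0 z1 : R -> R) (z : R -> R -> R) (f g : R -> R),
     Lploc2 p d -> Xp p z0 z1 -> solution p Sigma d z0 z1 z f g ->
     ((p < +oo)%E /\ Dp p d) \/
     (d t @[t --> +oo%R] --> ((0, 0) : R * R) /\
      forall eps : R, 0 < eps ->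
        (0 < ereal_inf [set (r - mu r)%:E | r in [set r : R | (eps <= r)%R]])%E) ->
     energy p z f g t @[t --> +oo%R] --> 0%E)
  /\
  ((p = +oo%E /\ (r - mu r) @[r --> +oo%R] --> +oo%R) \/
   ((p < +oo)%E /\
    exists M a b : R,
      [/\ 0 < M, 0 < a, 0 < b &
          forall x y : R, Sigma (x, y) -> ~ (enorm (x, y) < M) ->
            a * `|x| <= `|y| <= b * `|x|]) ->
   ISS p Sigma).

Proof.
have [Sigma0 dS _] := hSigma.
have S00 : S 0 0.
  have : (rotation @` Sigma) (0, 0).
    by exists (0, 0) => //; rewrite /rotation /= oppr0 addr0 mul0r.
  by rewrite -hS.
split; last first.
  move=> [[py growth]|[_ [M [a [b [M0 a0 b0 sector]]]]]].
    exact: (ISS_uniform hmu hS S00 hmu_lt py growth).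
  apply: (ISS_sector hmu hS hp).
  exact: (sector_contraction hmu hS S00 hmu_lt M0 a0 b0 dS sector).
move=> d z0 z1 z f g [md _] _ sol cond.
have [G [delta [[mG mdel G0 del0] GL hdel En rel]]] := solution_periods hp md sol.
have hdl := ae_periods hdel.
apply: (energy_cvg0 hp md sol) => e e0.
suff : \forall n \near \oo, (Lpnorm p `](-1)%R, 1%R[ (EFin \o period G n) <= e%:E)%E.
  by apply: filterS => n; rewrite En.
case: cond => [[plt [_ dD]]|[dto0 hgap]].
  have pr : p = (fine p)%:E by rewrite fineK// ge0_fin_numE// (le_trans _ hp).
  apply: (summable_decay hmu hS hmu_lt hp mG mdel G0 del0 GL rel pr) => //.
  rewrite (_ : Lpnorm _ _ _ = Lpnorm p `](-1)%R, 1%R[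
    (fun s => \sum_(0 <= n <oo) (enorm (d (s + 2 * n%:R + 1)))%:E)%E)//.
  apply: Lpnorm_ae_eq => //; apply: (aeS _ hdl) => s hs.
  rewrite /= in_itv/= => /andP[s1 _]; congr (`| _ |)%E.
  by apply: eq_eseriesr => n _; rewrite /period_input hs// addrA.
apply: (uniform_decay hmu hS hmu_lt hp mG G0 del0 GL rel) => //.
  by move=> eps eps0; apply: uniform_gap; exact: hgap.
move=> eta eta0; have [N hN] := enorm_vanishes dto0 eta0.
exists N; apply: (aeS _ hdl) => s hs s1 n Nn.
rewrite /period_input hs//; apply: hN.
by move: Nn; rewrite -(ler_nat R); lra.
Qed.
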